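(* For all partitions $\mu\subseteq\lambda$, as an identity of rational functions in $q$, $$\sum_{T\in\operatorname{SIT}(\lambda/\mu)} q^{|T|}\prod_{k=1}^{m(T)}\frac{1}{1-q^{a(T_{\ge k})}}\;=\;\sum_{D\in\mathcal D(\lambda/\mu)}\ \prod_{(i,j)\in\lambda\setminus D}\frac{q^{h(i,j)}}{1-q^{h(i,j)}}.$$
   Context: Partitions are identified with Young diagrams $\{(i,j):1\le j\le\lambda_i\}$ (English convention); $h(i,j)=\lambda_i-j+\lambda'_j-i+1$ is the hook length in $\lambda$ ($\lambda'$ the conjugate). A standard increasing tableau of shape $\lambda/\mu$ is a filling $T$ of the cells of $\lambda/\mu$ by positive integers, strictly increasing along rows and down columns, whose set of entries is exactly $\{1,\dots,m\}$ for some $m=m(T)$; $\operatorname{SIT}(\lambda/\mu)$ is their set. $|T|$ is the sum of the entries and $a(T_{\ge k})$ the number of cells with entry $\ge k$. Generalized excited diagrams: for $S\subseteq\lambda$, a cell $(i,j)\in S$ is active if $(i+1,j),(i,j+1),(i+1,j+1)\in\lambda\setminus S$; for active $(i,j)$ the type I move replaces $(i,j)$ by $(i+1,j+1)$ and the type II move adds $(i+1,j+1)$ to $S$. $\mathcal D(\lambda/\mu)$ is the set of subsets of $\lambda$ obtainable from the diagram of $\mu$ by sequences of type I and type II moves. *)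

(* Defs.v *)
From HB Require Import structures.
From mathcomp Require Import all_boot all_order all_algebra fraction.
Set Implicit Arguments. Unset Strict Implicit. Unset Printing Implicit Defensive.
Import Order.TTheory GRing.Theory Num.Theory.

(* Convention: cells are 0-indexed (row i, column j), i.e. paper cell
   (i+1, j+1).  A partition is a weakly decreasing seq of positive parts. *)
Definition is_partition (l : seq nat) : bool :=
  sorted geq l && all (fun x => 0 < x) l.

Definition subpartition (mu lam : seq nat) : Prop :=
  forall i, nth 0 mu i <= nth 0 lam i.

Definition conjpart (l : seq nat) (j : nat) : nat := count (fun x => j < x) l.

Definition hook (l : seq nat) (i j : nat) : nat :=
  (nth 0 l i - j) + (conjpart l j - i) - 1.

Definition box (l : seq nat) : finType := ('I_(size l) * 'I_(head 0 l))%type.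

Definition row (l : seq nat) (c : box l) : nat := val c.1.
Definition col (l : seq nat) (c : box l) : nat := val c.2.

Definition diag (lam p : seq nat) : {set box lam} :=
  [set c : box lam | col c < nth 0 p (row c)].

Definition skew (lam mu : seq nat) : {set box lam} := diag lam lam :\: diag lam mu.

(* fillings: values bounded by the number of cells of the box (the entries of
   a SIT are {1..m} with m <= #cells, so this loses nothing); cells outside
   lam/mu carry the dummy value 0. *)
Definition bnd (lam : seq nat) : nat := #|box lam|.+1.
Definition filling (lam : seq nat) : finType := {ffun box lam -> 'I_(bnd lam)}.

Definition is_SIT (lam mu : seq nat) (T : filling lam) : bool :=
  [&& [forall c, (c \notin skew lam mu) ==> (val (T c) == 0)],
      [forall c in skew lam mu, 0 < val (T c)],
      [forall c in skew lam mu, forall d in skew lam mu,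
         ((row c == row d) && (col c < col d)) ==> (val (T c) < val (T d))],
      [forall c in skew lam mu, forall d in skew lam mu,
         ((col c == col d) && (row c < row d)) ==> (val (T c) < val (T d))]
    & [exists m : 'I_(bnd lam), forall k : 'I_(bnd lam),
         [exists c in skew lam mu, val (T c) == val k] == (0 < val k <= val m)]].

Arguments is_SIT : clear implicits.

Definition SIT (lam mu : seq nat) : {set filling lam} :=
  [set T | is_SIT lam mu T].

Definition mT (lam mu : seq nat) (T : filling lam) : nat :=
  \max_(c in skew lam mu) val (T c).
Definition sizeT (lam mu : seq nat) (T : filling lam) : nat :=
  \sum_(c in skew lam mu) val (T c).
Definition aT (lam mu : seq nat) (T : filling lam) (k : nat) : nat :=
  #|[set c in skew lam mu | k <= val (T c)]|.

Arguments mT : clear implicits.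
Arguments sizeT : clear implicits.
Arguments aT : clear implicits.

Definition is_shift (lam : seq nat) (c d : box lam) (di dj : nat) : bool :=
  (row d == row c + di) && (col d == col c + dj).

Definition outside (lam : seq nat) (S : {set box lam}) (d : box lam) : bool :=
  (d \in diag lam lam) && (d \notin S).

Definition active (lam : seq nat) (S : {set box lam}) (c d : box lam) : bool :=
  [&& c \in S, is_shift c d 1 1, outside S d,
      [exists d1, is_shift c d1 1 0 && outside S d1]
    & [exists d2, is_shift c d2 0 1 && outside S d2]].

Definition ged_step (lam : seq nat) : rel {set box lam} :=
  fun S S' => [exists c, exists d, active S c d &&
                 ((S' == (S :\ c) :|: [set d]) || (S' == d |: S))].

Definition GED (lam mu : seq nat) : {set {set box lam}} :=
  [set D | connect (@ged_step lam) (diag lam mu) D].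

Local Open Scope ring_scope.

Definition qF : {fraction {poly rat}} := FracField.tofrac ('X : {poly rat}).

Definition SIT_side (lam mu : seq nat) : {fraction {poly rat}} :=
  \sum_(T in SIT lam mu)
     qF ^+ sizeT lam mu T *
     \prod_(1 <= k < (mT lam mu T).+1) (1 - qF ^+ aT lam mu T k)^-1.

Definition GED_side (lam mu : seq nat) : {fraction {poly rat}} :=
  \sum_(D in GED lam mu)
     \prod_(c in diag lam lam :\: D)
        (qF ^+ hook lam (row c) (col c) / (1 - qF ^+ hook lam (row c) (col c))).

(* Main.v *)
Require Import Defs.
From HB Require Import structures.
From mathcomp Require Import all_boot all_order all_algebra fraction.
From mathcomp Require Import zify ring.

(* Write [F(mu)] for either side.  Peeling off the entries equal to 1 of a tableau
   gives [F(mu) = q^|lam/mu| * sum F(nu)], where [nu] ranges over the partitions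
   obtained from [mu] by adding a (possibly empty) set of addable cells, and this
   recursion determines [F].  That the excited sum obeys it is a K-theoretic
   Chevalley formula.  Generalized excited diagrams are the subwords of the reading
   word of [lam] whose 0-Hecke product is [mu], so the sum can be built one letter
   at a time by Demazure-type operators.  Attach a variable to each boundary step of
   the rectangle containing [lam]; the operator of a letter commutes with
   "sum over [nu], divided by the weight of [mu]" provided the two variables at the
   letter are exchanged.  After specialization the ratio of these two variables is
   [q] to the power of the hook length of the corresponding cell. *)

Set Implicit Arguments. Unset Strict Implicit. Unset Printing Implicit Defensive.
Import GRing.Theory.

(** * Order ideals of cells in a rectangle *)

Section Cells.
Variables d n : nat.
Notation cell := ('I_d * 'I_n)%type.
Implicit Types (a b c e x : cell) (I J M D X : {set cell}) (w L : seq cell).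

(** The weight of [mu] does not commute with the operator of a letter unless two variables are
    exchanged, so the induction on the word must let the variables vary. What stays fixed is a
    scalar [w], independent of [mu]. It is identified only at the end, by evaluating at [mu = lam],
    where the sum over [nu] inside [lam] has a single term. Followed through all exchanges, each row
    and each column of [lam] keeps one variable, namely [q] to the position of its step in the
    boundary of [lam]. The letter of a cell compares the variables of its row and its column, and
    the distance between these two steps is the hook length.

    On the tableau side only nonempty sets of cells are peeled off, because the entry 1 occurs. The
    term [nu = mu] of the common recursion is hidden in the factor for [k = 1], the geometric series
    with ratio [q^|lam/mu|].

    No permutations occur: a Hecke product is a predicate on ideals, and a letter whose action would
    leave the Grassmannian elements is simply not allowed. *)

Definition cell_le c e := (c.1 <= e.1) && (c.2 <= e.2).
Definition same_diag c e := c.2 + e.1 == e.2 + c.1.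
Definition far c e := (c.2 + e.1).+1 < e.2 + c.1 \/ (e.2 + c.1).+1 < c.2 + e.1.
Definition ideal I := [forall c, forall e, (e \in I) && cell_le c e ==> (c \in I)].
Definition addable I c :=
  (c \notin I) && [forall x, cell_le x c && (x != c) ==> (x \in I)].
Definition removable I c :=
  (c \in I) && [forall x, cell_le c x && (x != c) ==> (x \notin I)].
(** Not the covering relation of Young's lattice: any set of addable cells, even the empty one, is
    added at once. *)
Definition covers I J := (I \subset J) && [forall c in J :\: I, addable I c].

Lemma cell_eqE c e : (c == e) = (c.1 == e.1 :> nat) && (c.2 == e.2 :> nat).
Proof. by []. Qed.

Lemma idealP I : reflect (forall c e, e \in I -> cell_le c e -> c \in I) (ideal I).
Proof.
apply: (iffP forallP) => [H c e eI le_ce | H c].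
  by move/forallP/(_ e): (H c); rewrite eI le_ce.
by apply/forallP=> e; apply/implyP=> /andP[]; apply: H.
Qed.

Lemma addableP I c :
  reflect (c \notin I /\ forall x, cell_le x c -> x != c -> x \in I) (addable I c).
Proof.
apply: (iffP andP) => -[cI H]; split=> //.
  by move=> x le_xc ne_xc; move/forallP/(_ x): H; rewrite le_xc ne_xc.
by apply/forallP=> x; apply/implyP=> /andP[]; apply: H.
Qed.

Lemma removableP I c :
  reflect (c \in I /\ forall x, cell_le c x -> x \in I -> x = c) (removable I c).
Proof.
apply: (iffP andP) => -[cI H]; split=> //.
  move=> x le_xc xI; apply/eqP; apply: contraLR xI => ne_xc.
  by move/forallP/(_ x): H; rewrite le_xc ne_xc.
apply/forallP=> x; apply/implyP=> /andP[le_cx]; apply: contraNN => xI.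
by apply/eqP; apply: H.
Qed.

Lemma coversP I J :
  reflect (I \subset J /\ forall c, c \in J -> c \notin I -> addable I c) (covers I J).
Proof.
apply: (iffP andP) => -[sIJ H]; split=> //.
  by move=> c cJ cI; move/forall_inP: H; apply; rewrite inE cI.
by apply/forall_inP=> c; rewrite inE => /andP[cI cJ]; apply: H.
Qed.

Lemma covers_ideal I J : ideal I -> covers I J -> ideal J.
Proof.
move=> /idealP idI /coversP[/subsetP sIJ H]; apply/idealP=> c e eJ le_ce.
have [eI|eI] := boolP (e \in I); first exact/sIJ/(idI _ _ eI).
have /addableP[_ He] := H _ eJ eI.
by have [-> //|ne_ce] := eqVneq c e; apply/sIJ/He.
Qed.

Lemma ideal_remove I c : ideal I -> removable I c -> ideal (I :\ c).
Proof.
move=> /idealP idI /removableP[cI mc]; apply/idealP=> x e.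
rewrite !inE => /andP[ne_ec eI] le_xe; rewrite (idI _ _ eI le_xe) andbT.
by apply: contraNneq ne_ec => ec; rewrite -ec (mc e) // -?ec.
Qed.

Lemma ideal_add I c : ideal I -> addable I c -> ideal (c |: I).
Proof.
move=> /idealP idI /addableP[cI mc]; apply/idealP=> x e.
rewrite !inE => /orP[/eqP-> le_xc|eI le_xe]; last by rewrite (idI _ _ eI le_xe) orbT.
by case: eqVneq => //= ne_xc; apply: mc.
Qed.

Lemma removable_add I c : ideal I -> addable I c -> removable (c |: I) c.
Proof.
move=> /idealP idI /addableP[cI mc]; apply/removableP; split=> [|x le_cx]; first by rewrite setU11.
by case/setU1P => // xI; case/negP: cI; apply: idI xI le_cx.
Qed.

Lemma addable_remove I c : ideal I -> removable I c -> addable (I :\ c) c.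
Proof.
move=> /idealP idI /removableP[cI mc]; apply/addableP; split=> [|x le_xc ne_xc]; first by rewrite setD11.
by rewrite !inE ne_xc; apply: idI cI le_xc.
Qed.

(** * Cells on a common diagonal *)

Lemma same_diag_trans a b c : same_diag a b -> same_diag b c -> same_diag a c.
Proof. rewrite /same_diag; lia. Qed.

Lemma same_diag_sym a b : same_diag a b = same_diag b a.
Proof. rewrite /same_diag; lia. Qed.

Lemma same_diag_refl a : same_diag a a.
Proof. by rewrite /same_diag. Qed.

Variant same_diag_spec c e : Prop :=
| SameDiagEq of c = e
| SameDiagLt of c.1 < e.1 & c.2 < e.2
| SameDiagGt of e.1 < c.1 & e.2 < c.2.

Lemma same_diagP c e : same_diag c e -> same_diag_spec c e.
Proof.
rewrite /same_diag => /eqP H.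
case: (ltngtP c.1 e.1) => h; [apply: SameDiagLt|apply: SameDiagGt|apply: SameDiagEq]; try lia.
apply/eqP; rewrite cell_eqE; lia.
Qed.

Lemma removable_uniq I c e : ideal I -> same_diag c e ->
  removable I c -> removable I e -> c = e.
Proof.
move=> idI /same_diagP[//|h1 h2|h1 h2] /removableP[cI mc] /removableP[eI me].
  by rewrite (mc e) // /cell_le; lia.
by rewrite (me c) // /cell_le; lia.
Qed.

Lemma addable_uniq I c e : ideal I -> same_diag c e ->
  addable I c -> addable I e -> c = e.
Proof.
move=> idI /same_diagP[//|h1 h2|h1 h2] /addableP[cI mc] /addableP[eI me].
  by case/negP: cI; apply: me; rewrite ?cell_eqE /cell_le; lia.
by case/negP: eI; apply: mc; rewrite ?cell_eqE /cell_le; lia.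
Qed.

(** A removable cell south-east of [c] would force [c] into [I]; one north-west of [c] would have
    the cell [(e.1, c.2)] of [I] to its right. *)
Lemma add_rem_excl I c e : ideal I -> same_diag c e -> addable I c -> ~~ removable I e.
Proof.
move=> idI Hd /addableP[cI mc]; apply/negP=> /removableP[eI me].
case: (same_diagP Hd) => [E|h1 h2|h1 h2].
- by rewrite -E (negPf cI) in eI.
- by case/negP: cI; move/idealP: idI; apply; first exact: eI; rewrite /cell_le; lia.
- have /eqP : (e.1, c.2) = e; last by rewrite cell_eqE /=; lia.
  apply: me; first by rewrite /cell_le /=; lia.
  by apply: mc; rewrite ?cell_eqE /cell_le /=; lia.
Qed.

(* Two consecutive Hecke steps on one diagonal cannot both remove a cell. *)
Lemma rem_rem_excl I c e : ideal I -> same_diag c e ->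
  removable I e -> ~~ removable (I :\ e) c.
Proof.
move=> idI Hd re; apply: (@add_rem_excl _ e); first exact: ideal_remove.
  by rewrite same_diag_sym.
exact: addable_remove.
Qed.

Lemma far_sym c e : far c e -> far e c.
Proof. rewrite /far; lia. Qed.

(** Only [e] could block [c] in [I]. But [far] leaves room for a third cell between [c] and [e],
    which would still block [c] after [e] is gone. *)
Lemma removable_far I c e : ideal I -> far c e ->
  removable I e -> removable (I :\ e) c -> removable I c.
Proof.
move=> idI farce /removableP[eI me] /removableP[]; rewrite !inE => /andP[ne cI] mc.
apply/removableP; split=> // x le_cx xI; apply/eqP/contraT => ne_xc.
have [xe|ne_xe] := eqVneq x e; last by rewrite (mc x) ?eqxx ?inE ?ne_xe in ne_xc *.
subst x; exfalso.
suff [x [le_x le_xe nxc nxe]] : exists x, [/\ cell_le c x, cell_le x e, x != c & x != e].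
  case/eqP: nxc; apply: mc => //; rewrite !inE nxe.
  by move/idealP: idI; apply; first exact: eI.
move: farce le_cx ne_xc; rewrite /far /cell_le => farce le_ce _.
case: (ltnP c.1 e.1) => h1; case: (ltnP c.2 e.2) => h2; try lia.
- by exists (c.1, e.2); rewrite !cell_eqE /=; split; lia.
- have h : c.1.+1 < d by have := ltn_ord e.1; lia.
  by exists (Ordinal h, c.2); rewrite !cell_eqE /=; split; lia.
- have h : c.2.+1 < n by have := ltn_ord e.2; lia.
  by exists (c.1, Ordinal h); rewrite !cell_eqE /=; split; lia.
Qed.

Lemma removable_sub I J c : J \subset I -> c \in J -> removable I c -> removable J c.
Proof.
move=> /subsetP sJI cJ /removableP[cI mc]; apply/removableP; split=> // x le_cx xJ.
by apply: mc => //; apply: sJI.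
Qed.

(** * Hecke products of words of cells *)

(* [hecke w M]: letting the simple reflection attached to the diagonal of each
   letter act by the 0-Hecke (Demazure) product, from the last letter of [w] to
   the first, takes the empty ideal to [M] without ever leaving the Grassmannian
   elements, i.e. every letter adds a cell or meets a removable cell. *)
Fixpoint hecke w M : bool :=
  if w is b :: w' then
    [exists c, [&& same_diag c b, removable M c & hecke w' M || hecke w' (M :\ c)]]
  else M == set0.

Lemma hecke_consP b w M :
  reflect (exists c, [/\ same_diag c b, removable M c & hecke w M \/ hecke w (M :\ c)])
          (hecke (b :: w) M).
Proof.
by apply: (iffP existsP) => -[c]; [case/and3P=> H1 H2 /orP H3|case=> H1 H2 /orP H3];
  exists c; [split | apply/and3P].
Qed.

Lemma hecke_diag b b' w M : same_diag b b' -> hecke (b :: w) M -> hecke (b' :: w) M.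
Proof.
move=> Hb /hecke_consP[c [H1 H2 H3]]; apply/hecke_consP; exists c; split=> //.
exact: same_diag_trans Hb.
Qed.

Lemma hecke_cat w0 w w' :
  (forall M, ideal M -> hecke w M -> hecke w' M) ->
  forall M, ideal M -> hecke (w0 ++ w) M -> hecke (w0 ++ w') M.
Proof.
move=> H; elim: w0 => [//|b w0 IH] M idM; rewrite !cat_cons.
move=> /hecke_consP[c [H1 H2 H3]]; apply/hecke_consP; exists c; split=> //.
by case: H3 => H3; [left|right]; apply: IH => //; apply: ideal_remove.
Qed.

Lemma hecke_swap a b w M : ideal M -> far a b ->
  hecke (a :: b :: w) M -> hecke (b :: a :: w) M.
Proof.
move=> idM fab /hecke_consP[c [dc rc Hc]].
have fce e : same_diag e b -> far c e by move: fab dc; rewrite /far /same_diag; lia.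
case: Hc => /hecke_consP[e [de re He]]; have fe := fce _ de.
  have ne_ce : c != e by apply/eqP=> E; move: fe; rewrite E /far; lia.
  apply/hecke_consP; exists e; split=> //; case: He => He; [left|right]; apply/hecke_consP.
    by exists c; split=> //; left.
  exists c; split=> //; last by left.
  apply: removable_sub (rc); rewrite ?subsetDl // !inE ne_ce.
  by case/removableP: rc.
have re' := removable_far idM (far_sym fe) rc re.
apply/hecke_consP; exists e; split=> //.
have ne_ce : c != e by apply/eqP=> E; move: fe; rewrite E /far; lia.
case: He => He; [left|right]; apply/hecke_consP; exists c; split=> //; first by right.
  apply: removable_sub (rc); rewrite ?subsetDl // !inE ne_ce.
  by case/removableP: rc.
right; suff -> : M :\ e :\ c = M :\ c :\ e by [].
by apply/setP=> x; rewrite !inE andbCA.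
Qed.

(** The 0-Hecke relation [s * s = s]: once a letter has removed a cell, the diagonal has an addable
    cell, so an equal letter cannot act next. *)
Lemma hecke_idem a b w M : ideal M -> same_diag a b ->
  hecke (a :: b :: w) M = hecke (b :: w) M.
Proof.
move=> idM dab; apply/idP/idP => /hecke_consP[c [dc rc Hc]].
  case: Hc => // /hecke_consP[e [de re He]].
  suff : ~~ removable (M :\ c) e by rewrite re.
  apply: rem_rem_excl => //; move: dab dc de; rewrite /same_diag; lia.
apply/hecke_consP; exists c; split=> //; first by move: dab dc; rewrite /same_diag; lia.
by left; apply/hecke_consP; exists c.
Qed.

Lemma hecke_move a w0 w M : ideal M -> (forall x, x \in w0 -> far a x) ->
  hecke (w0 ++ a :: w) M = hecke (a :: w0 ++ w) M.
Proof.
elim: w0 M => [//|b w0 IH] M idM farw.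
have fab : far a b by apply: farw; rewrite inE eqxx.
have IH' M' : ideal M' -> hecke (w0 ++ a :: w) M' = hecke (a :: w0 ++ w) M'.
  by move=> idM'; apply: IH => // x xw; apply: farw; rewrite inE xw orbT.
apply/idP/idP => H.
  apply: hecke_swap; rewrite //; first exact: far_sym.
  move: H; apply: (@hecke_cat [:: b]) => // M' idM'; by rewrite IH'.
have := hecke_swap idM fab H.
apply: (@hecke_cat [:: b]) => // M' idM'; by rewrite IH'.
Qed.

(** If the first letter adds a cell for one ideal and is absorbed for the other, a single ideal has
    an addable and a removable cell on one diagonal. If it adds a cell for both, the cells agree
    since a diagonal has at most one addable cell. *)
Lemma hecke_inj w M M' : ideal M -> ideal M' -> hecke w M -> hecke w M' -> M = M'.
Proof.
elim: w M M' => [|b w IH] M M' idM idM'; first by move=> /eqP-> /eqP->.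
move=> /hecke_consP[c [dc rc Hc]] /hecke_consP[e [de re He]].
have dce : same_diag c e by move: dc de; rewrite /same_diag; lia.
have iM := ideal_remove idM rc; have iM' := ideal_remove idM' re.
case: Hc => Hc; case: He => He.
- exact: IH.
- by have E := IH _ _ idM iM' Hc He; move: (rem_rem_excl idM' dce re); rewrite -E rc.
- have E := IH _ _ iM idM' Hc He.
  by rewrite same_diag_sym in dce; move: (rem_rem_excl idM dce rc); rewrite E re.
- have E := IH _ _ iM iM' Hc He.
  have ce : c = e.
    apply: (addable_uniq iM dce); first exact: addable_remove.
    by rewrite E; exact: addable_remove.
  have [cM _] := removableP _ _ rc; have [eM' _] := removableP _ _ re.
  by rewrite -(setD1K cM) E ce setD1K.
Qed.

(** Makes the two alternatives for a letter disjoint, so that a sum over subwords splits into two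
    sums. *)
Lemma hecke_add_excl w M c : ideal M -> removable M c ->
  hecke w M -> hecke w (M :\ c) = false.
Proof.
move=> idM rc H; apply/negP=> H'.
have E := hecke_inj idM (ideal_remove idM rc) H H'.
by have [+ _] := removableP _ _ rc; rewrite E setD11.
Qed.

(** * Linear extensions and excited moves *)

(* The letters of [L] are listed from the last cell to the first. *)
Fixpoint linext L : bool :=
  if L is b :: L' then [&& linext L', b \notin L' & ideal [set x in L]] else true.

Lemma linext_uniq L : linext L -> uniq L.
Proof. by elim: L => //= b L IH /and3P[/IH-> -> _]. Qed.

Lemma linext_ideal L : linext L -> ideal [set x in L].
Proof.
case: L => [_|b L /and3P[_ _ //]].
by apply/idealP=> c e; rewrite inE.
Qed.

Lemma linext_cat L1 L2 : linext (L1 ++ L2) -> linext L2.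
Proof. by elim: L1 => //= b L1 IH /and3P[/IH]. Qed.

Lemma set_cons (b : cell) L : [set x in b :: L] = b |: [set x in L].
Proof. by apply/setP=> x; rewrite !inE. Qed.

Lemma linext_removable b L : linext (b :: L) -> removable (b |: [set x in L]) b.
Proof.
move=> /= /and3P[lL bL]; rewrite set_cons => idL.
apply/removableP; split=> [|x le_bx]; first by rewrite setU11.
rewrite !inE => /orP[/eqP//|xL]; case/negP: bL.
by move/idealP: (linext_ideal lL) => /(_ b x); rewrite !inE; apply.
Qed.

Lemma linext_exists I : ideal I -> exists L, linext L /\ [set x in L] = I.
Proof.
move: {2}#|I| (erefl #|I|) => k; elim: k I => [|k IH] I.
  by move=> /eqP; rewrite cards_eq0 => /eqP-> _; exists [::]; split=> //; apply/setP=> x; rewrite !inE.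
move=> cI idI.
have [c0 c0I] : exists c, c \in I by apply/set0Pn; rewrite -card_gt0 cI.
have [c cI1 maxc] := arg_maxnP (fun c => c.1 + c.2) c0I.
have cI' : c \in I := cI1.
have rc : removable I c.
  apply/removableP; split=> // x le_cx xI; apply/eqP; rewrite cell_eqE.
  by move: (maxc _ xI) le_cx; rewrite /cell_le; lia.
have [||L [lL EL]] := IH (I :\ c); first by move: cI; rewrite (cardsD1 c) cI' => -[].
  exact: ideal_remove.
have E : [set x in c :: L] = I by rewrite set_cons EL setD1K.
exists (c :: L); rewrite E; split=> //; rewrite /= lL E idI andbT.
by have := setD11 c I; rewrite -EL inE => ->.
Qed.

Definition outer I D c := (c \in I) && (c \notin D).

Definition shifted c e i j := (e.1 == c.1 + i :> nat) && (e.2 == c.2 + j :> nat).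

Lemma shifted_diag c e : shifted c e 1 1 -> [/\ cell_le c e, c != e & same_diag c e].
Proof. by move=> /andP[/eqP h1 /eqP h2]; rewrite /cell_le /same_diag cell_eqE; split; lia. Qed.

Lemma far_between c e x1 x2 x :
  shifted c e 1 1 -> shifted c x1 1 0 -> shifted c x2 0 1 ->
  ~~ cell_le x c -> ~~ cell_le e x -> x != x1 -> x != x2 -> far c x.
Proof. rewrite /shifted !cell_eqE /far /cell_le; lia. Qed.

Definition excitable I D c e :=
  [&& c \in D, shifted c e 1 1, outer I D e,
      [exists x, shifted c x 1 0 && outer I D x]
    & [exists x, shifted c x 0 1 && outer I D x]].

(** Repeats the shape of [ged_step], so that the two relations are convertible when [I] is
    [diag lam lam]. *)
Definition excited_step I : rel {set cell} := fun D D' =>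
  [exists c, exists e, excitable I D c e &&
    ((D' == (D :\ c) :|: [set e]) || (D' == e |: D))].

Lemma excited_stepP I D D' :
  reflect (exists c e, excitable I D c e /\ (D' = e |: (D :\ c) \/ D' = e |: D))
          (excited_step I D D').
Proof.
apply: (iffP existsP) => -[c].
  move=> /existsP[e /andP[He /orP H]]; exists c, e; split=> //.
  by case: H => /eqP->; [left; rewrite setUC|right].
move=> [e [He H]]; exists c; apply/existsP; exists e; rewrite He /=.
by case: H => ->; [rewrite setUC eqxx|rewrite eqxx orbT].
Qed.

Definition letters L D := [seq b <- L | b \in D].

Lemma letters_eq L D D' : {in L, D =i D'} -> letters L D = letters L D'.
Proof. exact: eq_in_filter. Qed.

Lemma lettersU1 L D b : b \notin L -> letters L (b |: D) = letters L D.
Proof.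
move=> bL; apply: letters_eq => x xL; rewrite !inE.
by case: eqP => // E; rewrite E (negPf bL) in xL.
Qed.

Lemma lettersD1 L D b : b \notin L -> letters L (D :\ b) = letters L D.
Proof.
move=> bL; apply: letters_eq => x xL; rewrite !inE.
by case: eqP => // E; rewrite E (negPf bL) in xL.
Qed.

(* Only letters on the neighbouring diagonals fail to commute with [c], and those
   lying between [c] and [e] are the two cells required to be outside [D]. *)
Lemma hecke_step L D D' M : linext L -> D \subset [set x in L] -> ideal M ->
  excited_step [set x in L] D D' -> hecke (letters L D) M -> hecke (letters L D') M.
Proof.
move=> lL /subsetP sDL idM /excited_stepP[c [e [+ HD']]].
move=> /and5P[cD shce /andP[eL eD]].
move=> /existsP[x1 /andP[sh1 /andP[_ x1D]]] /existsP[x2 /andP[sh2 /andP[_ x2D]]].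
have [le_ce ne_ce dce] := shifted_diag shce.
have cL := sDL _ cD; rewrite !inE in eL cL.
case/splitPr: eL lL sDL cL => L1 L2 lL sDL cL.
have l2 := linext_cat lL.
have cL2 : c \in L2.
  have : c \in e :: L2.
    by move/idealP: (linext_ideal l2) => /(_ c e); rewrite !inE eqxx /= => ->.
  by rewrite inE (negPf ne_ce).
case/splitPr: cL2 l2 lL sDL cL => L2' L3 l2 lL sDL _.
have l3 : linext (c :: L3) by move: l2; rewrite -cat_cons => /linext_cat.
have := linext_uniq lL; rewrite cat_uniq /= => /and3P[u1 hL1 /andP[eLL u2]].
have := eLL; rewrite mem_cat negb_or => /andP[eL2 ec].
have cL1 : c \notin L1.
  by apply: contra hL1 => H; apply/orP; right; apply/hasP; exists c; rewrite // mem_cat inE eqxx orbT.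
have eL1 : e \notin L1 by apply: contra hL1 => H; rewrite /= H.
have [cL2 cL3] : c \notin L2' /\ c \notin L3.
  by move: u2; rewrite uniq_catC /= mem_cat negb_or => /andP[/andP[-> ->]].
have eL3 : e \notin L3 by move: ec; rewrite inE negb_or => /andP[].
have farL2 x : x \in letters L2' D -> far c x.
  rewrite mem_filter => /andP[xD xL2].
  have nxc : ~~ cell_le x c.
    apply/negP=> le_xc.
    have : x \in c :: L3.
      by move/idealP: (linext_ideal l3) => /(_ x c); rewrite !inE eqxx /= => ->.
    move: u2; rewrite cat_uniq => /and3P[_ /hasPn H _] xc.
    by have := H _ xc; rewrite /= xL2.
  have nex : ~~ cell_le e x.
    apply: contra eLL => le_ex.
    have /idealP /(_ e x) := linext_ideal (linext_cat (L1 := [:: e]) l2).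
    by rewrite !inE mem_cat xL2; apply.
  have n1 : x != x1 by apply: contraNneq x1D => <-.
  have n2 : x != x2 by apply: contraNneq x2D => <-.
  exact: far_between shce sh1 sh2 nxc nex n1 n2.
have E1 : letters (L1 ++ e :: L2' ++ c :: L3) D =
          letters L1 D ++ letters L2' D ++ c :: letters L3 D.
  by rewrite /letters !filter_cat /= (negPf eD) filter_cat /= cD.
rewrite E1; case: HD' => ->.
  have -> : letters (L1 ++ e :: L2' ++ c :: L3) (e |: D :\ c) =
            letters L1 D ++ e :: letters L2' D ++ letters L3 D.
    rewrite /letters !filter_cat /= filter_cat /= !inE !eqxx (negPf ne_ce) /=.
    by rewrite -!/(letters _ _) !lettersU1 ?lettersD1.
  apply: hecke_cat => // M' idM'; rewrite hecke_move //.
  exact: hecke_diag.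
(* Type II: bring [c] to the front of the block, double it by idempotence, rename one copy [e] and
   move the other back. *)
have -> : letters (L1 ++ e :: L2' ++ c :: L3) (e |: D) =
          letters L1 D ++ e :: letters L2' D ++ c :: letters L3 D.
  rewrite /letters !filter_cat /= filter_cat /= !inE !eqxx cD orbT /=.
  by rewrite -!/(letters _ _) !lettersU1.
apply: hecke_cat => // M' idM' H.
have H' : hecke (c :: letters L2' D ++ letters L3 D) M' by rewrite -hecke_move.
have : hecke (e :: c :: letters L2' D ++ letters L3 D) M'.
  by rewrite hecke_idem // same_diag_sym.
apply: (@hecke_cat [:: e]) => // M'' idM''; by rewrite hecke_move.
Qed.

Lemma hecke_letters_self L M : linext L -> ideal M -> M \subset [set x in L] ->
  hecke (letters L M) M.
Proof.
elim: L M => [|b L IH] M /=.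
  by move=> _ _ /subsetP sM; apply/eqP/setP=> x; rewrite inE; apply/negP=> /sM; rewrite inE.
move=> lbL idM sM; have /and3P[lL bL _] := lbL; rewrite set_cons in sM.
case: ifP => bM; last first.
  apply: IH => //; apply/subsetP=> x xM; move/subsetP/(_ x xM): sM.
  by rewrite !inE => /orP[/eqP E|//]; rewrite E bM in xM.
have rb : removable M b by exact: removable_sub (linext_removable lbL).
apply/hecke_consP; exists b; split; [exact: same_diag_refl|by []|right].
rewrite -/(letters L M) -(@lettersD1 L M b) //; apply: IH => //; first exact: ideal_remove.
apply/subsetP=> x; rewrite !inE => /andP[nxb xM]; move/subsetP/(_ x xM): sM.
by rewrite !inE (negPf nxb).
Qed.

(** A cell north-west of [b] is in the ideal [b :: L]. If [c] were south-east of [b], then [b] would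
    lie in [M :\ c] and hence in [L], where it does not occur. *)
Lemma hecke_cell b L M c : linext (b :: L) -> ideal M -> same_diag c b ->
  removable M c -> M :\ c \subset [set x in L] -> c \in b :: L.
Proof.
move=> lbL /idealP idM dc /removableP[cM mc] /subsetP sM.
have := linext_ideal lbL => /idealP /(_ c b).
rewrite !inE eqxx /= => H; case: (same_diagP dc) => [->|h1 h2|h1 h2]; first by rewrite eqxx.
  by apply: H => //; rewrite /cell_le; lia.
have bL : b \in L; last by case/and3P: lbL => _; rewrite bL.
have := sM b; rewrite !inE; apply; apply/andP; split; first by rewrite cell_eqE; lia.
by apply: idM cM _; rewrite /cell_le; lia.
Qed.

Lemma hecke_sub L D M : linext L -> ideal M -> hecke (letters L D) M ->
  M \subset [set x in L].
Proof.
elim: L M => [|b L IH] M /=; first by move=> _ _ /eqP->; rewrite sub0set.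
move=> lbL idM; have /and3P[lL bL _] := lbL.
have sL : [set x in L] \subset [set x in b :: L] by rewrite set_cons subsetUr.
case: ifP => bD; last by move=> H; apply: subset_trans sL; apply: IH.
case/hecke_consP=> c [dc rc [H|H]]; first by apply: subset_trans sL; apply: IH.
have sM := IH _ lL (ideal_remove idM rc) H.
apply/subsetP=> x xM; have [->|nxc] := eqVneq x c.
  by rewrite inE; apply: hecke_cell dc rc sM.
by move/subsetP: sL; apply; move/subsetP: sM; apply; rewrite !inE nxc.
Qed.

Lemma excitable_sub I J D c e X : I \subset J -> [disjoint X & I] ->
  excitable I D c e -> excitable J (D :|: X) c e.
Proof.
move=> /subsetP sIJ dX.
have out x : outer I D x -> outer J (D :|: X) x.
  move=> /andP[xI xD]; rewrite /outer sIJ // inE negb_or xD /=.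
  by rewrite (disjointFl dX).
move=> /and5P[cD sh /out oe /existsP[x1 /andP[s1 /out o1]] /existsP[x2 /andP[s2 /out o2]]].
rewrite /excitable inE cD sh oe /=; apply/andP.
by split; apply/existsP; [exists x1; rewrite s1|exists x2; rewrite s2].
Qed.

(** Moves inside [I] neither use nor need empty any cell of [X]; this lets an induction on [L] set
    aside its first letter. *)
Lemma excited_step_sub I J D D' X : I \subset J -> [disjoint X & I] -> D \subset I ->
  excited_step I D D' -> excited_step J (D :|: X) (D' :|: X).
Proof.
move=> sIJ dX sDI /excited_stepP[c [e [He HD]]]; apply/excited_stepP; exists c, e.
split; first exact: excitable_sub He.
case: HD => ->; [left|right]; last by rewrite setUA.
rewrite -setUA; congr (_ :|: _); apply/setP=> x; rewrite !inE; case: eqP => //= ->.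
by rewrite (disjointFl dX) //; move/subsetP: sDI; apply; case/and5P: He.
Qed.

Lemma excited_step_subset I D D' : D \subset I -> excited_step I D D' -> D' \subset I.
Proof.
move=> sDI /excited_stepP[c [e [/and5P[_ _ /andP[eI _] _ _] HD]]].
case: HD => ->; rewrite subUset sub1set eI //=.
by apply: subset_trans sDI; apply: subsetDl.
Qed.

Lemma connect_excited_subset I D D' :
  D \subset I -> connect (excited_step I) D D' -> D' \subset I.
Proof.
move=> + /connectP[p]; elim: p D => [D sDI _ -> //|D1 p IH D sDI /= /andP[s1 pp] E].
by apply: IH pp E; apply: excited_step_subset s1.
Qed.

Lemma connect_excited_sub I J D D' X : I \subset J -> [disjoint X & I] -> D \subset I ->
  connect (excited_step I) D D' -> connect (excited_step J) (D :|: X) (D' :|: X).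
Proof.
move=> sIJ dX + /connectP[p]; elim: p D => [D _ _ -> //|D1 p IH D sDI /= /andP[s1 pp] E].
apply: (connect_trans (connect1 (excited_step_sub sIJ dX sDI s1))).
by apply: IH pp E; apply: excited_step_subset s1.
Qed.

Lemma next_cell c b : same_diag c b -> c.1 < b.1 -> exists e, shifted c e 1 1.
Proof.
move=> dc lt_cb; have h1 : c.1 + 1 < d by have := ltn_ord b.1; lia.
have h2 : c.2 + 1 < n by move: dc (ltn_ord b.2); rewrite /same_diag; lia.
by exists (Ordinal h1, Ordinal h2); rewrite /shifted /= !eqxx.
Qed.

Lemma excitable_removable I D c e : ideal I -> removable D c -> e \in I ->
  shifted c e 1 1 -> excitable I D c e.
Proof.
move=> /idealP idI /removableP[cD mc] eI /andP[/eqP h1 /eqP h2].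
have out x : cell_le c x -> x != c -> cell_le x e -> outer I D x.
  move=> le_cx ne_xc le_xe; rewrite /outer (idI _ _ eI) //=.
  by apply: contra ne_xc => xD; apply/eqP/mc.
rewrite /excitable cD /shifted h1 h2 !eqxx out ?cell_eqE /cell_le; try lia.
rewrite /=; apply/andP; split; apply/existsP.
  by exists (e.1, c.2); rewrite /= h1 addn0 !eqxx out ?cell_eqE /cell_le /=; lia.
by exists (c.1, e.2); rewrite /= h2 addn0 !eqxx out ?cell_eqE /cell_le /=; lia.
Qed.

(** Since [c] is removable, [M] has no cell weakly south-east of the next diagonal cell, so type I
    moves stay available all the way to [b]. *)
Lemma slide I M b c : ideal I -> b \in I -> same_diag c b -> c.1 <= b.1 ->
  c \notin M -> removable (c |: M) c ->
  connect (excited_step I) (c |: M) (b |: M).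
Proof.
move=> idI bI; move: {2}(b.1 - c.1) (erefl (b.1 - c.1)) => k.
elim: k c => [|k IH] c Ek dc le_cb cM rc.
  suff -> : c = b by exact: connect0.
  by case: (same_diagP dc) => // *; lia.
have [|e He] := next_cell dc; first by lia.
have [/eqP h1 /eqP h2] := andP He.
have eI : e \in I.
  by move/idealP: idI; apply; first exact: bI; move: dc; rewrite /cell_le /same_diag; lia.
have eM x : cell_le e x -> x \notin M.
  move=> le_ex; apply/negP=> xM; have [_ mc] := removableP _ _ rc.
  have := mc x _ (setU1r _ xM); rewrite /cell_le => E.
  have xc : x = c by apply: E; move: le_ex; rewrite /cell_le; lia.
  by move: le_ex; rewrite xc /cell_le; lia.
apply: (@connect_trans _ _ (e |: M)).
  apply: connect1; apply/excited_stepP; exists c, e.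
  by split; [exact: excitable_removable|left; rewrite setU1K].
apply: IH; try lia.
- by move: dc; rewrite /same_diag; lia.
- by apply: eM; rewrite /cell_le; lia.
- apply/removableP; split=> [|x le_ex]; first by rewrite setU11.
  by rewrite !inE (negPf (eM _ le_ex)) orbF => /eqP.
Qed.

(** A type II move leaves the original at [c]; its copy then slides on to [b]. *)
Lemma slide_copy I M b c : ideal I -> b \in I -> same_diag c b -> c.1 < b.1 ->
  removable M c -> connect (excited_step I) M (b |: M).
Proof.
move=> idI bI dc lt_cb rc; have [e He] := next_cell dc lt_cb.
have [/eqP h1 /eqP h2] := andP He.
have eI : e \in I.
  by move/idealP: idI; apply; first exact: bI; move: dc; rewrite /cell_le /same_diag; lia.
have eM x : cell_le e x -> x \notin M.
  move=> le_ex; apply/negP=> xM; have [_ mc] := removableP _ _ rc.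
  have := mc x _ xM; rewrite /cell_le => E.
  have xc : x = c by apply: E; move: le_ex; rewrite /cell_le; lia.
  by move: le_ex; rewrite xc /cell_le; lia.
apply: (@connect_trans _ _ (e |: M)).
  apply: connect1; apply/excited_stepP; exists c, e.
  by split; [exact: excitable_removable|right].
apply: slide => //; try lia.
- by move: dc; rewrite /same_diag; lia.
- by apply: eM; rewrite /cell_le; lia.
- apply/removableP; split=> [|x le_ex]; first by rewrite setU11.
  by rewrite !inE (negPf (eM _ le_ex)) orbF => /eqP.
Qed.

(** Induction on [L]. A letter [b] that adds [c] is matched by sliding [c] to [b], an absorbed
    letter by sliding a copy; the remaining moves avoid [b]. *)
Lemma hecke_connect L D M : linext L -> D \subset [set x in L] -> ideal M ->
  hecke (letters L D) M -> connect (excited_step [set x in L]) M D.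
Proof.
elim: L D M => [|b L IH] D M.
  move=> _ sD _ /eqP->; suff -> : D = set0 by exact: connect0.
  by apply/eqP; rewrite -subset0; apply: subset_trans sD _; apply/subsetP=> x; rewrite inE.
move=> lbL sD idM; have /= /and3P[lL bL _] := lbL; rewrite set_cons.
have sL : [set x in L] \subset b |: [set x in L] by rewrite subsetUr.
have dL : [disjoint [set b] & [set x in L]] by rewrite disjoints1 inE.
have dL0 : [disjoint set0 & [set x in L]] by rewrite disjoints_subset sub0set.
have idL : ideal (b |: [set x in L]) by rewrite -set_cons; apply: linext_ideal.
case: ifP => bD; last first.
  move=> H; have sD' : D \subset [set x in L].
    apply/subsetP=> x xD; move/subsetP/(_ x xD): sD; rewrite !inE => /orP[/eqP E|//].
    by rewrite E bD in xD.
  have := connect_excited_sub sL dL0 (hecke_sub lL idM H) (IH _ _ lL sD' idM H).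
  by rewrite !setU0.
have sD' : D :\ b \subset [set x in L].
  apply/subsetP=> x; rewrite !inE => /andP[nxb xD]; move/subsetP/(_ x xD): sD.
  by rewrite set_cons !inE (negPf nxb).
have main N : ideal N -> hecke (letters L D) N ->
    connect (excited_step (b |: [set x in L])) (b |: N) D.
  move=> idN HN; rewrite -(lettersD1 _ bL) in HN.
  have := connect_excited_sub sL dL (hecke_sub lL idN HN) (IH _ _ lL sD' idN HN).
  by rewrite ![_ :|: [set b]]setUC setD1K.
move=> /hecke_consP[c [dc rc Hc]]; have [cM mc] := removableP _ _ rc.
have idMc := ideal_remove idM rc.
(* [b] is a maximal cell of the ideal, so [c] is not beyond it and has only to slide south-east. *)
have le_cb : c.1 <= b.1.
  have cL : c \in b |: [set x in L].
    rewrite -set_cons inE; apply: hecke_cell dc rc _ => //.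
    case: Hc => H; last exact: hecke_sub H.
    by apply: subset_trans (hecke_sub lL idM H); apply: subsetDl.
  have [_ mb] := removableP _ _ (linext_removable lbL).
  case: (same_diagP dc) => [->|/ltnW|h1 h2] //.
  by rewrite (mb c) // /cell_le (ltnW h1) (ltnW h2).
case: Hc => H.
  apply: connect_trans (main _ idM H); apply: (slide_copy (c := c)); rewrite ?setU11 //.
  have sM := hecke_sub lL idM H.
  rewrite ltn_neqAle le_cb andbT; apply/eqP=> E.
  have cb : c = b by case: (same_diagP dc) => // [h1 _|h1 _]; move: h1; rewrite E ltnn.
  by move/subsetP/(_ c cM): sM; rewrite inE cb (negPf bL).
apply: connect_trans (main _ idMc H).
rewrite -{1}(setD1K cM); apply: slide; rewrite ?setU11 ?setD11 ?setD1K //.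
Qed.

Lemma connect_hecke L D M : linext L -> M \subset [set x in L] -> ideal M ->
  connect (excited_step [set x in L]) M D -> hecke (letters L D) M.
Proof.
move=> lL sM idM /connectP[p pp ->{D}].
suff H D : D \subset [set x in L] -> hecke (letters L D) M ->
    path (excited_step [set x in L]) D p -> hecke (letters L (last D p)) M.
  by apply: H => //; apply: hecke_letters_self.
elim: p {pp} D => //= D1 p IH D sD HD /andP[s1 pp].
by apply: IH => //; [exact: excited_step_subset s1|exact: hecke_step s1 HD].
Qed.

End Cells.

(** * The boundary lattice path of an ideal *)

Section Positions.
Variables d n : nat.
Notation cell := ('I_d * 'I_n)%type.
Implicit Types (a b c e x : cell) (I J M N D X : {set cell}) (w L : seq cell).

Lemma card_ord_lt k m : m <= k -> #|[set i : 'I_k | i < m]| = m.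
Proof.
by move=> le_mk; rewrite -sum1dep_card -(big_ord_widen k (fun=> 1) le_mk) sum1_card card_ord.
Qed.

Lemma down_closed_card k (A : {set 'I_k}) :
  (forall i j : 'I_k, j \in A -> i <= j -> i \in A) -> forall i, (i \in A) = (i < #|A|).
Proof.
move=> dA i; apply/idP/idP => [iA|].
  rewrite -[i.+1](@card_ord_lt k) ?ltn_ord //; apply/subset_leq_card/subsetP => j.
  by rewrite inE ltnS; apply: dA.
apply: contraTT => iA; rewrite -leqNgt -[X in _ <= X](@card_ord_lt k); last exact/ltnW.
apply/subset_leq_card/subsetP => j jA; rewrite inE ltnNge; apply: contra iA.
exact: dA.
Qed.

Definition row_len I (r : 'I_d) := #|[set j | (r, j) \in I]|.
Definition col_len I (j : 'I_n) := #|[set r | (r, j) \in I]|.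

Lemma row_lenP I c : ideal I -> (c \in I) = (c.2 < row_len I c.1).
Proof.
case: c => r j /idealP idI /=; rewrite -down_closed_card ?inE // => i k.
by rewrite !inE => kI le_ik; apply: idI kI _; rewrite /cell_le leqnn.
Qed.

Lemma col_lenP I c : ideal I -> (c \in I) = (c.1 < col_len I c.2).
Proof.
case: c => r j /idealP idI /=; rewrite -down_closed_card ?inE // => i k.
by rewrite !inE => kI le_ik; apply: idI kI _; rewrite /cell_le leqnn andbT.
Qed.

Lemma row_len_le I r : row_len I r <= n.
Proof. by rewrite -[n in _ <= n]card_ord max_card. Qed.

Lemma col_len_le I j : col_len I j <= d.
Proof. by rewrite -[d in _ <= d]card_ord max_card. Qed.

Lemma row_len_anti I (r r' : 'I_d) : ideal I -> r <= r' -> row_len I r' <= row_len I r.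
Proof.
move=> /idealP idI le_rr'; apply/subset_leq_card/subsetP => j; rewrite !inE => H.
by apply: idI H _; rewrite /cell_le /= le_rr' leqnn.
Qed.

Lemma col_len_anti I (j j' : 'I_n) : ideal I -> j <= j' -> col_len I j' <= col_len I j.
Proof.
move=> /idealP idI le_jj'; apply/subset_leq_card/subsetP => r; rewrite !inE => H.
by apply: idI H _; rewrite /cell_le /= le_jj' leqnn.
Qed.

(* The boundary of an ideal is a lattice path with [d + n] steps numbered from
   the south-west; [row_pos] and [col_pos] locate its vertical and horizontal steps,
   and [diag_pos c], [(diag_pos c).+1] are the two steps exchanged by adding [c]. *)
Definition row_pos I (r : 'I_d) := row_len I r + (d - r.+1).
Definition col_pos I (j : 'I_n) := j + (d - col_len I j).
Definition diag_pos c := c.2 + (d - c.1.+1).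
Definition swap s p := if p == s then s.+1 else if p == s.+1 then s else p.

Lemma swap_l s : swap s s = s.+1.
Proof. by rewrite /swap eqxx. Qed.

Lemma swap_r s : swap s s.+1 = s.
Proof. by rewrite /swap eqxx gtn_eqF. Qed.

Lemma swap_id s p : p != s -> p != s.+1 -> swap s p = p.
Proof. by rewrite /swap => /negPf-> /negPf->. Qed.

Lemma same_diag_pos b c : same_diag b c = (diag_pos b == diag_pos c).
Proof.
by rewrite /same_diag /diag_pos; have := ltn_ord b.1; have := ltn_ord c.1; lia.
Qed.

Lemma row_pos_inj I : ideal I -> injective (row_pos I).
Proof.
move=> idI r r' E; apply/val_inj; case: (ltngtP r r') => // h.
  by have := row_len_anti idI (ltnW h); move: E (ltn_ord r'); rewrite /row_pos; lia.
by have := row_len_anti idI (ltnW h); move: E (ltn_ord r); rewrite /row_pos; lia.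
Qed.

Lemma col_pos_inj I : ideal I -> injective (col_pos I).
Proof.
move=> idI j j' E; apply/val_inj; case: (ltngtP j j') => // h.
  by have := col_len_anti idI (ltnW h); move: E; rewrite /col_pos; lia.
by have := col_len_anti idI (ltnW h); move: E; rewrite /col_pos; lia.
Qed.

Lemma row_len_removable M c : ideal M -> removable M c -> row_len M c.1 = c.2.+1.
Proof.
move=> idM /removableP[cM mc]; have lt_c := cM; rewrite row_lenP // in lt_c.
apply/eqP; rewrite eqn_leq lt_c andbT leqNgt; apply/negP => lt2.
have h : c.2.+1 < n by apply: leq_trans (row_len_le M c.1).
have := mc (c.1, Ordinal h); rewrite row_lenP //= lt2 /cell_le /= leqnn leqnSn.
by move=> /(_ isT isT) E; have := congr1 (fun x : cell => val x.2) E => /=; lia.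
Qed.

Lemma col_len_removable M c : ideal M -> removable M c -> col_len M c.2 = c.1.+1.
Proof.
move=> idM /removableP[cM mc]; have lt_c := cM; rewrite col_lenP // in lt_c.
apply/eqP; rewrite eqn_leq lt_c andbT leqNgt; apply/negP => lt2.
have h : c.1.+1 < d by apply: leq_trans (col_len_le M c.2).
have := mc (Ordinal h, c.2); rewrite col_lenP //= lt2 /cell_le /= leqnn leqnSn.
by move=> /(_ isT isT) E; have := congr1 (fun x : cell => val x.1) E => /=; lia.
Qed.

Lemma row_len_remove M c r : c \in M -> row_len (M :\ c) r = row_len M r - (r == c.1).
Proof.
move=> cM; rewrite /row_len; case: eqP => [->|ne_r].
  rewrite [in RHS](cardsD1 c.2) inE -surjective_pairing cM addKn.
  by apply: eq_card => j; rewrite !inE -pair_eqE /= eqxx.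
by rewrite subn0; apply: eq_card => j; rewrite !inE -pair_eqE /=; case: eqP.
Qed.

Lemma col_len_remove M c j : c \in M -> col_len (M :\ c) j = col_len M j - (j == c.2).
Proof.
move=> cM; rewrite /col_len; case: eqP => [->|ne_j].
  rewrite [in RHS](cardsD1 c.1) inE -surjective_pairing cM addKn.
  by apply: eq_card => r; rewrite !inE -pair_eqE /= eqxx andbT.
by rewrite subn0; apply: eq_card => r; rewrite !inE -pair_eqE /=; case: (j =P c.2) ne_j => //; rewrite andbF.
Qed.

Lemma row_pos_removable M c : ideal M -> removable M c -> row_pos M c.1 = (diag_pos c).+1.
Proof. by move=> idM rc; rewrite /row_pos row_len_removable. Qed.

Lemma col_pos_removable M c : ideal M -> removable M c -> col_pos M c.2 = diag_pos c.
Proof. by move=> idM rc; rewrite /col_pos col_len_removable. Qed.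

Lemma row_pos_remove M c r : ideal M -> removable M c ->
  row_pos (M :\ c) r = if r == c.1 then diag_pos c else row_pos M r.
Proof.
move=> idM rc; have [cM _] := removableP _ _ rc; rewrite /row_pos row_len_remove //.
by case: eqP => [->|_]; rewrite ?subn0 // row_len_removable // subn1.
Qed.

Lemma col_pos_remove M c j : ideal M -> removable M c ->
  col_pos (M :\ c) j = if j == c.2 then (diag_pos c).+1 else col_pos M j.
Proof.
move=> idM rc; have [cM _] := removableP _ _ rc; rewrite /col_pos col_len_remove //.
case: eqP => [->|_]; rewrite ?subn0 // col_len_removable // subn1 /diag_pos /=.
by have := ltn_ord c.1; lia.
Qed.

(** Whether step [s] of the boundary is vertical. *)
Definition has_pos M s := [exists r, row_pos M r == s].

Lemma has_pos_removable M c : ideal M -> removable M c ->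
  has_pos M (diag_pos c).+1 && ~~ has_pos M (diag_pos c).
Proof.
move=> idM rc; apply/andP; split.
  by apply/existsP; exists c.1; rewrite row_pos_removable.
apply/existsP => -[r /eqP Er].
have E : row_pos (M :\ c) r = row_pos (M :\ c) c.1.
  by rewrite !row_pos_remove // eqxx; case: eqP.
move: Er; rewrite (row_pos_inj (ideal_remove idM rc) E) row_pos_removable //; lia.
Qed.

Lemma has_pos_addable M c : ideal M -> addable M c ->
  has_pos M (diag_pos c) && ~~ has_pos M (diag_pos c).+1.
Proof.
move=> idM ac; have idc := ideal_add idM ac; have rc := removable_add idM ac.
have E r : row_pos M r = if r == c.1 then diag_pos c else row_pos (c |: M) r.
  by rewrite -row_pos_remove // setU1K //; case/addableP: ac.
apply/andP; split; first by apply/existsP; exists c.1; rewrite E eqxx.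
apply/existsP => -[r]; rewrite E; case: (r =P c.1) => [_|ne]; first by rewrite ltn_eqF.
by rewrite -(row_pos_removable idc rc) => /eqP /(row_pos_inj idc).
Qed.

(** A vertical step preceded by a horizontal one is an outer corner: were the next row equally long,
    its step would be [s]. *)
Lemma removable_exists M s : ideal M -> has_pos M s.+1 -> ~~ has_pos M s ->
  exists2 c, diag_pos c = s & removable M c.
Proof.
move=> idM /existsP[r /eqP Er] Ns.
have below (r' : 'I_d) : r < r' -> row_len M r' < row_len M r.
  move=> lt_r; have h : r.+1 < d by apply: leq_ltn_trans (ltn_ord r').
  have ne : row_pos M (Ordinal h) != s by apply: contra Ns => E; apply/existsP; exists (Ordinal h).
  have le1 := @row_len_anti M r (Ordinal h) idM (leqnSn r).
  have le2 := @row_len_anti M (Ordinal h) r' idM lt_r.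
  by move: ne Er le1 le2; rewrite /row_pos /=; lia.
have r0 : 0 < row_len M r.
  case: (ltnP r.+1 d) => h; first by have := @below (Ordinal h) (leqnn _); lia.
  by move: Er; rewrite /row_pos; lia.
have h : (row_len M r).-1 < n by have := row_len_le M r; lia.
exists (r, Ordinal h); first by move: Er; rewrite /diag_pos /row_pos /=; lia.
apply/removableP; split; first by rewrite row_lenP //= prednK.
move=> x /andP[/= le1 le2]; rewrite row_lenP // => lt_x.
have Er' : x.1 = r.
  apply/val_inj/eqP; rewrite eqn_leq le1 andbT leqNgt; apply/negP=> /below; lia.
by apply/eqP; rewrite cell_eqE /= Er' eqxx /=; move: lt_x; rewrite Er'; lia.
Qed.

(** Dual to [removable_exists]. Taking the position from a cell [b] keeps it below the last step
    [d + n - 1], where a full top row ends and nothing can be added. *)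
Lemma addable_exists M b : ideal M -> has_pos M (diag_pos b) -> ~~ has_pos M (diag_pos b).+1 ->
  exists2 c, diag_pos c = diag_pos b & addable M c.
Proof.
move=> idM /existsP[r /eqP Er] Ns.
have above (r' : 'I_d) : r' < r -> row_len M r < row_len M r'.
  move=> lt_r; have h : r.-1 < d by have := ltn_ord r; lia.
  have ne : row_pos M (Ordinal h) != (diag_pos b).+1.
    by apply: contra Ns => E; apply/existsP; exists (Ordinal h).
  have le1 := @row_len_anti M (Ordinal h) r idM (leq_pred r).
  have le2 : row_len M (Ordinal h) <= row_len M r' by apply: row_len_anti => //=; lia.
  by move: ne Er le1 le2 (ltn_ord r); rewrite /row_pos /=; lia.
have rn : row_len M r < n.
  case: (posnP r) => [r0|r0]; last first.
    have h : r.-1 < d by have := ltn_ord r; lia.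
    apply: leq_trans (above (Ordinal h) _) (row_len_le _ _) => /=; lia.
  by move: Er; rewrite /row_pos /diag_pos r0; have := ltn_ord b.2; have := ltn_ord b.1; lia.
exists (r, Ordinal rn); first by move: Er; rewrite {1}/diag_pos.
apply/addableP; split; first by rewrite row_lenP //= ltnn.
move=> x /andP[/= le1 le2]; rewrite row_lenP //.
case: (ltngtP x.1 r) => [lt _|gt|E]; try lia.
  exact: leq_ltn_trans le2 (above _ lt).
have {}E : x.1 = r by apply/val_inj.
by rewrite E cell_eqE /= E eqxx /=; lia.
Qed.

Lemma sum_row_len M : \sum_r row_len M r = #|M|.
Proof.
rewrite -sum1_card (eq_bigr (fun r => \sum_(j | (r, j) \in M) 1)); last first.
  by move=> r _; rewrite /row_len -sum1_card; apply: eq_bigl => j; rewrite inE.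
by rewrite pair_big_dep /=; apply: eq_bigl => -[].
Qed.

End Positions.

Local Open Scope ring_scope.

(** * The K-theoretic Chevalley formula *)

Section Chevalley.
Variables (d n : nat) (F : fieldType).
Notation cell := ('I_d * 'I_n)%type.
Implicit Types (b c e x : cell) (I J M N D X : {set cell}) (L : seq cell).
Implicit Types (z : nat -> F) (y : cell -> F) (f : {set cell} -> F).

Definition pos_weight z M := \prod_r z (row_pos M r).

Lemma pos_weight_remove z M c : ideal M -> removable M c ->
  z (diag_pos c) != 0 ->
  pos_weight z M = pos_weight z (M :\ c) * (z (diag_pos c).+1 / z (diag_pos c)).
Proof.
move=> idM rc nz; rewrite /pos_weight (bigD1 c.1) //= [in RHS](bigD1 c.1) //=.
rewrite row_pos_remove // eqxx row_pos_removable //.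
rewrite [in RHS](eq_bigr (fun r => z (row_pos M r))); last first.
  by move=> r /negPf ne; rewrite row_pos_remove // ne.
by field.
Qed.

Lemma pos_weight_swap z M s : ideal M -> z s != 0 -> z s.+1 != 0 ->
  pos_weight (z \o swap s) M = pos_weight z M *
    (if has_pos M s then z s.+1 / z s else 1) *
    (if has_pos M s.+1 then z s / z s.+1 else 1).
Proof.
move=> idM nz1 nz2.
(* At most one row ends at position [p], so a conditional factor is a product over all rows. *)
have single (g : F) p : (if has_pos M p then g else 1) =
    \prod_r (if row_pos M r == p then g else 1).
  case: ifP => [/existsP[r /eqP Er]|/existsP H].
    rewrite (bigD1 r) //= Er eqxx big1 ?mulr1 // => r' ne.
    by case: eqP => // E; case/eqP: ne; apply: (row_pos_inj idM); rewrite E.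
  by rewrite big1 // => r _; case: ifP => // E; case: H; exists r.
rewrite !single -!big_split /=; apply: eq_bigr => r _; rewrite /comp /swap.
case: (row_pos M r =P s) => [->|_]; first by rewrite ltn_eqF // mulr1; field.
by case: (row_pos M r =P s.+1) => [->|_]; [field|rewrite !mulr1].
Qed.

(** The weights sit on [D] rather than on its complement, so that a chosen letter multiplies by its
    weight and the sum obeys a recursion in [L]. Dividing by the product over all cells restores the
    complement. *)
Definition excited_sum y L M :=
  \sum_(D : {set cell} | (D \subset [set x in L]) && hecke (letters L D) M) \prod_(c in D) y c.

Lemma excited_sum_nil y M : excited_sum y [::] M = (M == set0)%:R.
Proof.
rewrite /excited_sum; case: (altP eqP) => [->|ne].
  rewrite (big_pred1 set0) ?big_set0 // => D /=; rewrite eqxx andbT.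
  apply/idP/eqP => [|->]; last exact: sub0set.
  by move=> /subsetP H; apply/setP=> x; rewrite inE; apply/negP=> /H; rewrite inE.
by rewrite big_pred0 // => D; rewrite /= (negPf ne) andbF.
Qed.

(** The sum over [c] has at most one term. For [b] in [D], its two summands correspond to [b] being
    absorbed and to [b] adding [c]. *)
Lemma excited_sum_cons y b L M : linext (b :: L) -> ideal M ->
  excited_sum y (b :: L) M = excited_sum y L M +
   \sum_(c | same_diag c b && removable M c)
      y b * (excited_sum y L M + excited_sum y L (M :\ c)).
Proof.
move=> lbL idM; have /= /and3P[lL bL _] := lbL.
rewrite {1}/excited_sum (bigID (fun D : {set cell} => b \in D)) /= addrC; congr (_ + _).
  apply: eq_bigl => D; rewrite set_cons; case: ifP => bD /=.
    rewrite andbF; apply/esym/negP => /andP[/subsetP /(_ b bD)].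
    by rewrite inE (negPf bL).
  rewrite andbT; congr (_ && _); apply/subsetP/subsetP => H x xD.
    by have := H x xD; rewrite !inE => /orP[/eqP E|//]; rewrite -E xD in bD.
  by rewrite inE H ?orbT.
rewrite (reindex_onto (fun D => b |: D) (fun D => D :\ b)) /=; last first.
  by move=> D /andP[_ bD]; rewrite setD1K.
transitivity (\sum_(D : {set cell} | (D \subset [set x in L]) && hecke (b :: letters L D) M)
     y b * \prod_(c in D) y c).
  apply: eq_big => [D|D /andP[_ /eqP E]]; last first.
    by rewrite big_setU1 // -E setD11.
  rewrite setU11 andbT -/(letters L (b |: D)) lettersU1 //.
  apply/idP/idP.
    case/andP => /andP[s1 ->] /eqP E; rewrite andbT.
    rewrite -E; apply/subsetP=> x; rewrite !inE => /andP[nxb]; rewrite (negPf nxb) /= => xD.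
    by move/subsetP/(_ x): s1; rewrite set_cons !inE xD (negPf nxb) orbT; apply.
  case/andP => s1 ->; rewrite set_cons setUS //= setU1K //.
  by apply/negP => /(subsetP s1); rewrite inE (negPf bL).
have [/existsP[c0 /andP[d0 r0]]|/existsP none] :=
    boolP [exists c, same_diag c b && removable M c]; last first.
  rewrite [RHS]big_pred0; last by move=> c; apply/negP => H; case: none; exists c.
  rewrite big_pred0 // => D; apply/negP => /andP[_ /hecke_consP[c [H1 H2 _]]].
  by case: none; exists c; rewrite H1.
have uniq0 c : same_diag c b -> removable M c -> c = c0.
  move=> H1 H2; apply: (removable_uniq idM) => //.
  by apply: same_diag_trans H1 _; rewrite same_diag_sym.
rewrite [RHS](big_pred1 c0); last first.
  by move=> c; apply/andP/eqP => [[]|->]; [exact: uniq0|].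
rewrite -mulr_sumr; congr (_ * _); rewrite /excited_sum.
rewrite (bigID (fun D => hecke (letters L D) M)) /=; congr (_ + _); apply: eq_bigl => D.
  rewrite -andbA; congr (_ && _); apply: andb_idl => H.
  by apply/hecke_consP; exists c0; split=> //; left.
rewrite -andbA; congr (_ && _); apply/andP/idP => [[/hecke_consP[c [H1 H2 H3]] H4]|H].
  by rewrite -(uniq0 c) //; case: H3 => // H3; rewrite H3 in H4.
split; first by apply/hecke_consP; exists c0; split=> //; right.
by apply/negP => H'; rewrite hecke_add_excl in H.
Qed.

Lemma coversxx M : covers M M.
Proof. by apply/coversP; split=> // c ->. Qed.

Lemma covers_removable M N c : ideal M -> covers M N -> addable M c -> c \in N ->
  removable N c.
Proof.
move=> /idealP idM /coversP[_ cov] ac cN; have [cM _] := addableP _ _ ac.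
apply/removableP; split=> // x le_cx xN; apply/eqP; apply: contraNT cM => ne_xc.
have [xM|xM] := boolP (x \in M); first exact: idM xM le_cx.
by have /addableP[_] := cov _ xN xM; apply; rewrite // eq_sym.
Qed.

Lemma covers_setU1 M N c : addable M c -> covers M (c |: N) = (M \subset N) && covers M N.
Proof.
move=> ac; have [cM _] := addableP _ _ ac; apply/coversP/andP => [[sMN cov]|].
  have sN : M \subset N.
    apply/subsetP=> x xM; move/subsetP/(_ x xM): sMN; rewrite !inE.
    by case: eqP => // E; rewrite -E xM in cM.
  by split=> //; apply/coversP; split=> // x xN; apply: cov; rewrite !inE xN orbT.
case=> sMN /coversP[_ cov]; split; first by apply: subset_trans sMN _; apply: subsetUr.
by move=> x; rewrite !inE => /orP[/eqP->|]; [|apply: cov].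
Qed.

Lemma covers_setD1 M N c : addable M c -> covers M N -> covers M (N :\ c).
Proof.
move=> ac /coversP[/subsetP sMN cov]; have [cM _] := addableP _ _ ac.
apply/coversP; split=> [|x]; last by rewrite !inE => /andP[_]; apply: cov.
apply/subsetP=> x xM; rewrite !inE sMN // andbT.
by apply: contraNneq cM => <-.
Qed.

(** Whether the addable cell [c] is included is independent of the other added cells, so the covers
    of [M] pair up as [N] and [N :\ c]. *)
Lemma covers_toggle f M c : ideal M -> addable M c ->
  \sum_(N | covers M N && (c \in N)) (f N + f (N :\ c)) = \sum_(N | covers M N) f N.
Proof.
move=> idM ac; rewrite big_split [RHS](bigID (fun N : {set cell} => c \in N)) /=.
congr (_ + _).
rewrite [RHS](reindex_onto (fun N => N :\ c) (fun N => c |: N)) /=; last first.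
  by move=> N /andP[_ cN]; rewrite setU1K.
apply: eq_bigl => N; rewrite setD11 andbT; apply/idP/idP.
  by move=> /andP[cov cN]; rewrite covers_setD1 //= setD1K.
move=> /andP[cov /eqP E]; have cN : c \in N by rewrite -E setU11.
by have := covers_setU1 (N :\ c) ac; rewrite E cov (andP cov).1 cN => ->.
Qed.

(** If [c] stays removable in [N], no added cell rests on it, so all of them were already addable to
    [M :\ c]. The resulting sum is one to which [covers_toggle] applies. *)
Lemma covers_remove M N c : ideal M -> removable M c ->
  covers M N && removable N c = covers (M :\ c) N && (c \in N).
Proof.
move=> idM rc; have [cM mc] := removableP _ _ rc; have ac := addable_remove idM rc.
have idMc := ideal_remove idM rc.
apply/andP/andP => [[/coversP[sMN cov] rN]|[cov cN]].
  have [cN mN] := removableP _ _ rN; split=> //; apply/coversP; split.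
    by apply: subset_trans sMN; apply: subsetDl.
  move=> e eN; rewrite !inE negb_and negbK; case: (eqVneq e c) => [->//|ne] /= eM.
  have [_ me] := addableP _ _ (cov e eN eM); apply/addableP; rewrite !inE negb_and eM orbT.
  split=> // x le_xe ne_xe; rewrite !inE me // andbT; apply: contraNneq ne => xc.
  by apply/eqP/mN; rewrite -?xc.
have rN := covers_removable idMc cov ac cN; split=> //.
have [sMN add] := coversP _ _ cov; apply/coversP; split.
  by rewrite -(setD1K cM) subUset sub1set cN.
move=> e eN eM; have [|_ me] := addableP _ _ (add e eN _); first by rewrite !inE (negPf eM) andbF.
by apply/addableP; split=> // x le_xe ne_xe; have := me x le_xe ne_xe; rewrite !inE => /andP[].
Qed.

Definition covers_sum f M := \sum_(N | covers M N) f N.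

(* [compatible y z L] ties the weight of each letter of [L] to the values of [z] at
   the two steps it exchanges, [z] being swapped accordingly as letters are undone. *)
Fixpoint compatible y z L : Prop :=
  if L is b :: L' then
    1 + y b = z (diag_pos b) / z (diag_pos b).+1 /\ compatible y (z \o swap (diag_pos b)) L'
  else True.

(* The K-theoretic Chevalley formula: it holds for the empty word, and the
   operator adding a letter commutes with [covers_sum]. *)
Lemma chevalley y z L : linext L -> (forall p, z p != 0) -> compatible y z L ->
  exists w, forall M, ideal M ->
    covers_sum (excited_sum y L) M = w * pos_weight z M * excited_sum y L M.
Proof.
elim: L z => [|b L IH] z.
  (* The scalar is fixed here, with the variables as left by all exchanges, and every later letter
     passes it on unchanged. *)
  move=> _ nz _; exists (pos_weight z set0)^-1 => M idM; rewrite excited_sum_nil.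
  case: (altP eqP) => [->|ne].
    rewrite mulVf ?mul1r; last by apply/prodf_neq0.
    rewrite /covers_sum (bigD1 set0) ?coversxx //= excited_sum_nil eqxx big1 ?addr0 //.
    by move=> N /andP[_ /negPf ne]; rewrite excited_sum_nil ne.
  rewrite mulr0 /covers_sum big1 // => N /coversP[sMN _]; rewrite excited_sum_nil.
  by case: eqP => // E; move: sMN; rewrite E subset0 (negPf ne).
move=> lbL nz [ey /IH] {}IH; have /= /and3P[lL bL _] := lbL.
have [|w Hw] := IH lL; first by move=> p; exact: nz.
exists w => M idM; rewrite excited_sum_cons //.
set s := diag_pos b in ey Hw; set K := excited_sum y L in Hw *.
have key : covers_sum (excited_sum y (b :: L)) M = covers_sum K M +
    \sum_(N | covers M N) \sum_(c | same_diag c b && removable N c) y b * (K N + K (N :\ c)).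
  rewrite /covers_sum -big_split /=; apply: eq_bigr => N cov.
  by rewrite excited_sum_cons //; apply: covers_ideal cov.
have Hz N : ideal N -> pos_weight (z \o swap s) N = _ := fun idN => pos_weight_swap idN (nz s) (nz s.+1).
have toggled c M' : same_diag c b -> ideal M' -> addable M' c ->
    covers_sum K M' = w * (pos_weight z M' * (z s.+1 / z s)) * K M' /\
    ~~ [exists e, same_diag e b && removable M' e].
  move=> dc idM' ac; have Es : diag_pos c = s by move: dc; rewrite same_diag_pos => /eqP.
  split.
    rewrite Hw // Hz // -Es; have /andP[-> /negPf->] := has_pos_addable idM' ac.
    by rewrite mulr1.
  apply/existsP => -[e /andP[de re]].
  have dce : same_diag c e by apply: same_diag_trans dc _; rewrite same_diag_sym.
  by have := add_rem_excl idM' dce ac; rewrite re.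
have diag_b c e : same_diag c b -> same_diag e b -> same_diag e c.
  by move=> dc de; apply: same_diag_trans de _; rewrite same_diag_sym.
rewrite key.
have [/existsP[c0 /andP[d0 a0]]|/existsP noadd] :=
    boolP [exists c, same_diag c b && addable M c].
  have [HM /existsP norem] := toggled c0 M d0 idM a0.
  rewrite [X in _ = _ * (_ + X)]big_pred0; last by move=> c; apply/negP => H; case: norem; exists c.
  (* The letter acts only on the larger member of each pair [N], [N :\ c0], which reproduces
     [covers_sum K M]. The factor [1 + y b] then cancels the effect of the exchange on the
     weight. *)
  have -> : \sum_(N | covers M N) \sum_(c | same_diag c b && removable N c) y b * (K N + K (N :\ c))
      = y b * covers_sum K M.
    rewrite /covers_sum -(covers_toggle K idM a0) mulr_sumr [RHS]big_mkcondr /=.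
    apply: eq_bigr => N cov; case: ifP => c0N.
      rewrite (big_pred1 c0) // => c; apply/andP/eqP => [[dc rc]|->].
        apply: (removable_uniq (covers_ideal idM cov)) => //; first exact: diag_b.
        exact: covers_removable cov a0 c0N.
      by split=> //; apply: covers_removable cov a0 c0N.
    rewrite big_pred0 // => c; apply/negP => /andP[dc rc].
    have [cN _] := removableP _ _ rc; have [sMN ad] := coversP _ _ cov.
    have [cM|cM] := boolP (c \in M).
      by case: norem; exists c; rewrite dc (removable_sub sMN).
    by rewrite -(addable_uniq idM (diag_b _ _ d0 dc) (ad _ cN cM) a0) cN in c0N.
  rewrite -[X in X + _]mul1r -mulrDl ey HM; field; by rewrite !nz.
have [/existsP[c0 /andP[d0 r0]]|/existsP norem] :=
    boolP [exists c, same_diag c b && removable M c].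
  have a0 := addable_remove idM r0; have idM0 := ideal_remove idM r0.
  have [HM _] := toggled c0 _ d0 idM0 a0.
  have Es : diag_pos c0 = s by move: d0; rewrite same_diag_pos => /eqP.
  (* The letter acts exactly on the covers in which [c0] is still removable; they are the covers of
     [M :\ c0] that contain [c0]. *)
  have -> : \sum_(N | covers M N) \sum_(c | same_diag c b && removable N c) y b * (K N + K (N :\ c))
      = y b * covers_sum K (M :\ c0).
    rewrite /covers_sum -(covers_toggle K idM0 a0) mulr_sumr.
    under [RHS]eq_bigl => N do rewrite -covers_remove //.
    rewrite [RHS]big_mkcondr /=; apply: eq_bigr => N cov.
    have uniq0 c : same_diag c b -> removable N c -> c = c0.
      move=> dc rc; have [cN _] := removableP _ _ rc; have [sMN ad] := coversP _ _ cov.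
      have [cM|cM] := boolP (c \in M).
        apply: (removable_uniq idM) (r0); first exact: diag_b.
        exact: removable_sub sMN cM rc.
      by case: noadd; exists c; rewrite dc ad.
    case: ifP => rN.
      by rewrite (big_pred1 c0) // => c; apply/andP/eqP => [[]|->//]; exact: uniq0.
    rewrite big_pred0 // => c; apply/negP => /andP[dc rc].
    by rewrite -(uniq0 c) // rc in rN.
  rewrite [X in _ = _ * (_ + X)](big_pred1 c0); last first.
    move=> c; apply/andP/eqP => [[dc rc]|->//].
    by apply: (removable_uniq idM) (r0); first exact: diag_b.
  rewrite HM Hw // Hz //.
  have := has_pos_removable idM r0; rewrite Es => /andP[-> /negPf->].
  have := @pos_weight_remove z M c0 idM r0; rewrite Es => -> //.
  have -> : y b = z s / z s.+1 - 1 by rewrite -ey; ring.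
  field; by rewrite !nz.
rewrite [X in _ = _ * (_ + X)]big_pred0; last by move=> c; apply/negP => H; case: norem; exists c.
rewrite [X in _ + X = _]big1; last first.
  move=> N cov; rewrite big_pred0 // => c; apply/negP => /andP[dc rc].
  have [cN _] := removableP _ _ rc; have [sMN ad] := coversP _ _ cov.
  have [cM|cM] := boolP (c \in M).
    by case: norem; exists c; rewrite dc (removable_sub sMN).
  by case: noadd; exists c; rewrite dc ad.
rewrite !addr0 Hw // Hz //.
(* Two steps of the same kind leave the weight invariant under the exchange; two of different kinds
   would form a corner, excluded here. *)
case: (boolP (has_pos M s)) => h1; case: (boolP (has_pos M s.+1)) => h2.
- field; by rewrite !nz.
- have [c dc ac] := addable_exists idM h1 h2.
  by case: noadd; exists c; rewrite same_diag_pos dc eqxx.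
- have [c dc rc] := removable_exists idM h2 h1.
  by case: norem; exists c; rewrite same_diag_pos dc eqxx.
- by rewrite !mulr1.
Qed.

End Chevalley.

(** * Specialization of the variables to hook lengths *)

Section ExcitedSeries.
Variables (d n : nat) (F : fieldType) (q : F).
Hypotheses (q_neq0 : q != 0) (q_aperiodic : forall k, (0 < k)%N -> q ^+ k != 1).
Notation cell := ('I_d * 'I_n)%type.
Implicit Types (b c e x : cell) (I J M N D X : {set cell}) (L : seq cell).

Definition hook_len I c := (row_len I c.1 - c.2 + (col_len I c.2 - c.1) - 1)%N.

(** The inverse of [q^h / (1 - q^h)]. Adding 1 gives the pure power [q^-h], as a ratio of two
    variables must be. *)
Definition hook_weight I c := (q ^+ hook_len I c)^-1 - 1.

Lemma hook_len_gt0 I c : ideal I -> c \in I -> (0 < hook_len I c)%N.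
Proof.
move=> idI cI; have h1 := cI; rewrite row_lenP // in h1.
by rewrite col_lenP // in cI; rewrite /hook_len; lia.
Qed.

Lemma hook_weight_neq0 I c : ideal I -> c \in I -> hook_weight I c != 0.
Proof.
by move=> idI cI; rewrite subr_eq0 invr_eq1; apply/q_aperiodic/hook_len_gt0.
Qed.

(** [pi] sends a boundary step of the current ideal to the step of the same row or column in the
    boundary of [I]. Undoing [b] exchanges the steps of its row and its column, and composing [pi]
    with [swap] compensates for that. *)
Lemma hook_compatible I L pi : ideal I -> linext L -> [set x in L] \subset I ->
  (forall r, pi (row_pos [set x in L] r) = row_pos I r) ->
  (forall j, pi (col_pos [set x in L] j) = col_pos I j) ->
  compatible (hook_weight I) (fun p => q ^+ pi p) L.
Proof.
move=> idI; elim: L pi => // b L IH pi lbL sLI Hr Hc.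
have /= /and3P[lL bL idbL] := lbL.
have rb : removable [set x in b :: L] b by rewrite set_cons; apply: linext_removable.
have EL : [set x in b :: L] :\ b = [set x in L].
  by rewrite set_cons setU1K // inE.
have bI : b \in I by apply: (subsetP sLI); rewrite !inE eqxx.
have E1 : pi (diag_pos b).+1 = row_pos I b.1 by rewrite -Hr row_pos_removable.
have E0 : pi (diag_pos b) = col_pos I b.2 by rewrite -Hc col_pos_removable.
split.
  rewrite E1 E0 /hook_weight addrC subrK.
  (* The steps ending the column and the row of [b] are as far apart as arm plus leg plus one. *)
  have -> : row_pos I b.1 = (col_pos I b.2 + hook_len I b)%N.
    have h1 := bI; rewrite row_lenP // in h1; have h2 := bI; rewrite col_lenP // in h2.
    have := ltn_ord b.1; have := col_len_le I b.2.
    by rewrite /row_pos /col_pos /hook_len; lia.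
  by rewrite exprD invfM mulrA divff ?expf_neq0 // mul1r.
have idL := ideal_remove idbL rb.
apply: (IH (pi \o swap (diag_pos b))) => //.
- by apply: subset_trans sLI; rewrite -EL subsetDl.
- move=> r; rewrite -EL -Hr row_pos_remove //=.
  case: eqP => [->|ne]; first by rewrite swap_l row_pos_removable.
  rewrite swap_id //; apply/eqP => E.
    have := row_pos_inj idL (x1 := r) (x2 := b.1); rewrite !row_pos_remove // eqxx.
    by case: eqP => // _ /(_ E).
  by apply: ne; apply: (row_pos_inj idbL); rewrite E row_pos_removable.
- move=> j; rewrite -EL -Hc col_pos_remove //=.
  case: eqP => [->|ne]; first by rewrite swap_r col_pos_removable.
  rewrite swap_id //; apply/eqP => E.
    by apply: ne; apply: (col_pos_inj idbL); rewrite E col_pos_removable.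
  have := col_pos_inj idL (x1 := j) (x2 := b.2); rewrite !col_pos_remove // eqxx.
  by case: eqP => // _ /(_ E).
Qed.

Lemma covers_sub M N : covers M N -> M \subset N.
Proof. by case/coversP. Qed.

Lemma excited_sum_out y L M : linext L -> ideal M -> ~~ (M \subset [set x in L]) ->
  excited_sum y L M = 0 :> F.
Proof.
move=> lL idM nsM; rewrite /excited_sum big_pred0 // => D; apply/negP => /andP[_ H].
by case/negP: nsM; apply: hecke_sub H.
Qed.

Lemma connect_excited_top I D : connect (excited_step I) I D = (D == I).
Proof.
apply/idP/eqP => [/connectP[[_ -> //|D' p] /= /andP[/excited_stepP[c [e [H _]]]]]|->];
  last exact: connect0.
by case/and5P: H => _ _ /andP[->].
Qed.

Lemma connect_excitedE L M D : linext L -> ideal M -> M \subset [set x in L] ->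
  connect (excited_step [set x in L]) M D = (D \subset [set x in L]) && hecke (letters L D) M.
Proof.
move=> lL idM sM; apply/idP/andP => [H|[sD H]]; last exact: hecke_connect.
by split; [exact: connect_excited_subset H|exact: connect_hecke H].
Qed.

Definition excited_series I M :=
  \sum_(D | connect (excited_step I) M D)
     \prod_(c in I :\: D) (q ^+ hook_len I c / (1 - q ^+ hook_len I c)).

Lemma excited_series_top I : excited_series I I = 1.
Proof.
rewrite /excited_series (big_pred1 I) ?setDv ?big_set0 // => D /=.
exact: connect_excited_top.
Qed.

Lemma excited_seriesE L M (I := [set x in L]) : linext L -> ideal M -> M \subset I ->
  excited_series I M = \prod_(c in I) (hook_weight I c)^-1 * excited_sum (hook_weight I) L M.
Proof.
move=> lL idM sM; have idI : ideal I := linext_ideal lL.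
rewrite /excited_series /excited_sum mulr_sumr.
apply: eq_big => [D|D]; rewrite connect_excitedE // => /andP[sD _].
rewrite [X in X * _](big_setID D) /= (setIidPr sD) mulrC mulrA -big_split /=.
rewrite [X in _ = X * _]big1 ?mul1r; last first.
  by move=> c cD; rewrite divff // hook_weight_neq0 // (subsetP sD).
apply: eq_bigr => c; rewrite inE => /andP[_ cI].
have h0 : q ^+ hook_len I c != 0 by rewrite expf_neq0.
by rewrite -invf_div mulrBl mul1r divff.
Qed.

Lemma excited_series_rec I M : ideal I -> ideal M -> M \subset I ->
  excited_series I M =
  q ^+ #|I :\: M| * \sum_(N | covers M N && (N \subset I)) excited_series I N.
Proof.
move=> idI idM sM; have [L [lL EL]] := linext_exists idI; subst I.
set I := [set x in L] in idI sM *; set y := hook_weight I.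
have compat : compatible y (fun p => q ^+ p) L by apply: (@hook_compatible I L id).
have [|w Hw] := chevalley lL _ compat; first by move=> p; rewrite expf_neq0.
(* The positions of the vertical steps add up to [#|N|] plus a constant. *)
have weight (N : {set cell}) : pos_weight (fun p => q ^+ p) N = q ^+ #|N| * pos_weight (fun p => q ^+ p) (set0 : {set cell}).
  have sum_pos (N' : {set cell}) : (\sum_r row_pos N' r = #|N'| + \sum_(r < d) (d - r.+1))%N.
    by rewrite /row_pos big_split /= sum_row_len.
  by rewrite /pos_weight !prodrXr !sum_pos cards0 exprD.
have nz0 : pos_weight (fun p => q ^+ p) (set0 : {set cell}) != 0.
  by apply/prodf_neq0 => r _; rewrite expf_neq0.
have sumE N : ideal N -> N \subset I -> covers_sum (excited_sum y L) N =
    \sum_(N' | covers N N' && (N' \subset I)) excited_sum y L N'.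
  move=> idN sN; rewrite /covers_sum [LHS](bigID (fun N' : {set cell} => N' \subset I)) /=.
  rewrite [X in _ + X]big1 ?addr0 // => N' /andP[cov nsN'].
  by apply: excited_sum_out => //; apply: covers_ideal cov.
have KI : excited_sum y L I != 0.
  rewrite /excited_sum (big_pred1 I) => [|D]; last first.
    by rewrite -connect_excitedE // connect_excited_top.
  by apply/prodf_neq0 => c cI; apply: hook_weight_neq0.
(* Inside [I] the only cover of [I] is [I] itself, and its excited sum is nonzero, which determines
   [w]. *)
have wI : w * pos_weight (fun p => q ^+ p) I = 1.
  apply: (mulIf KI); rewrite mul1r -Hw // sumE // (big_pred1 I) // => N /=.
  apply/andP/eqP => [[/covers_sub s1 s2]|->]; last by rewrite coversxx.
  by apply/eqP; rewrite eqEsubset s1 s2.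
rewrite excited_seriesE // -/y.
rewrite (eq_bigr (fun N => \prod_(c in I) (y c)^-1 * excited_sum y L N)); last first.
  by move=> N /andP[cov sN]; rewrite excited_seriesE //; apply: covers_ideal cov.
rewrite -mulr_sumr -sumE // Hw //.
rewrite mulrCA; congr (_ * _); rewrite mulrA -[LHS]mul1r; congr (_ * _).
rewrite -wI (weight I) (weight M) -(cardsID M I) (setIidPr sM) exprD; ring.
Qed.

End ExcitedSeries.

(** * Increasing tableaux and removal of their first level *)

Section Tableaux.
Variables (d n : nat).
Notation cell := ('I_d * 'I_n)%type.
Notation bound := (#|{: cell}|.+1).
Notation fill := {ffun cell -> 'I_bound}.
Implicit Types (b c e x : cell) (I J M N D X : {set cell}) (T : fill).

(** Has the shape of [is_SIT], to which it is convertible when [X] is a skew diagram. *)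
Definition is_tableau X T : bool :=
  [&& [forall c, (c \notin X) ==> (val (T c) == 0%N)],
      [forall c in X, (0 < val (T c))%N],
      [forall c in X, forall e in X,
         ((val c.1 == val e.1) && (val c.2 < val e.2)%N) ==> (val (T c) < val (T e))%N],
      [forall c in X, forall e in X,
         ((val c.2 == val e.2) && (val c.1 < val e.1)%N) ==> (val (T c) < val (T e))%N]
    & [exists m : 'I_bound, forall k : 'I_bound,
         [exists c in X, val (T c) == val k] == (0 < val k <= val m)%N]].

Definition max_entry X T : nat := \max_(c in X) val (T c).
Definition sum_entries X T : nat := \sum_(c in X) val (T c).
Definition count_ge X T (k : nat) : nat := #|[set c in X | (k <= val (T c))%N]|.

Record tableau_spec X T : Prop := TableauSpec {
  tab_out : forall c, c \notin X -> T c = 0%N :> nat;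
  tab_pos : forall c, c \in X -> (0 < T c)%N;
  tab_row : forall c e, c \in X -> e \in X -> c.1 = e.1 -> (c.2 < e.2)%N -> (T c < T e)%N;
  tab_col : forall c e, c \in X -> e \in X -> c.2 = e.2 -> (c.1 < e.1)%N -> (T c < T e)%N;
  tab_all : forall k, (0 < k <= max_entry X T)%N -> exists2 c, c \in X & T c = k :> nat
}.

Lemma le_max_entry X T c : c \in X -> (T c <= max_entry X T)%N.
Proof. by move=> cX; rewrite /max_entry (bigmax_sup c). Qed.

Lemma tableauP X T : reflect (tableau_spec X T) (is_tableau X T).
Proof.
apply: (iffP and5P) => [[H1 H2 H3 H4 /existsP[m /forallP H5]]|[H1 H2 H3 H4 H5]].
  split.
  - by move=> c cX; move/forallP/(_ c): H1; rewrite cX => /eqP.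
  - by move=> c cX; move/forall_inP: H2; apply.
  - move=> c e cX eX E lt; move/forall_inP/(_ c cX)/forall_inP/(_ e eX): H3.
    by rewrite E eqxx lt.
  - move=> c e cX eX E lt; move/forall_inP/(_ c cX)/forall_inP/(_ e eX): H4.
    by rewrite E eqxx lt.
  - move=> k /andP[k0 le_k].
    have le_max : (max_entry X T <= m)%N.
      apply/bigmax_leqP => c cX; have /eqP E := H5 (T c).
      have : [exists e in X, val (T e) == val (T c)] by apply/exists_inP; exists c.
      by rewrite E => /andP[].
    have lt_k : (k < bound)%N by apply: leq_ltn_trans (ltn_ord m); apply: leq_trans le_max.
    have /eqP := H5 (Ordinal lt_k); rewrite /= k0 (leq_trans le_k le_max) /=.
    by move=> /exists_inP[c cX /eqP E]; exists c.
split.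
- by apply/forallP=> c; apply/implyP=> /H1 E; apply/eqP.
- by apply/forall_inP.
- apply/forall_inP=> c cX; apply/forall_inP=> e eX; apply/implyP=> /andP[/eqP E lt].
  by apply: H3 => //; apply/val_inj.
- apply/forall_inP=> c cX; apply/forall_inP=> e eX; apply/implyP=> /andP[/eqP E lt].
  by apply: H4 => //; apply/val_inj.
- have lt_m : (max_entry X T < bound)%N.
    rewrite ltnS; apply/bigmax_leqP => c _; rewrite -ltnS; exact: ltn_ord.
  apply/existsP; exists (Ordinal lt_m); apply/forallP=> k; apply/eqP.
  apply/exists_inP/idP => /=.
    by move=> [c cX /eqP <-]; rewrite H2 //= le_max_entry.
  by move=> /H5[c cX E]; exists c; rewrite // E.
Qed.

Lemma max_entry_card X T : tableau_spec X T -> (max_entry X T <= #|X|)%N.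
Proof.
move=> tT; have := @uniq_leq_size _ (iota 1 (max_entry X T)) [seq val (T c) | c <- enum X].
rewrite iota_uniq size_iota size_map -cardE; apply=> // k.
rewrite mem_iota add1n ltnS => /(tab_all tT)[c cX E].
by apply/mapP; exists c; rewrite ?mem_enum.
Qed.

Section Peel.
Variables I M : {set cell}.
Hypotheses (idI : ideal I) (idM : ideal M) (sMI : M \subset I).

Definition first_level T := M :|: [set c in I :\: M | val (T c) == 1%N].
Definition lower T : fill := [ffun c => inord (T c).-1].
(** On a tableau of [I :\: N] the cells of [N :\: M] carry the dummy value 0, so raising all of
    [I :\: M] gives them the entry 1. *)
Definition raise T : fill := [ffun c => if c \in I :\: M then inord (T c).+1 else ord0].

Lemma lowerE T c : lower T c = (T c).-1 :> nat.
Proof. by rewrite ffunE inordK // (leq_ltn_trans (leq_pred _)). Qed.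

(** The comparison goes through the corner [(c.1, e.2)], which lies in the skew shape because [I]
    and [M] are ideals. *)
Lemma tableau_mono T c e : tableau_spec (I :\: M) T ->
  c \in I :\: M -> e \in I :\: M -> cell_le c e -> c != e -> (T c < T e)%N.
Proof.
move=> tT cX eX le_ce ne_ce.
have xX : (c.1, e.2) \in I :\: M.
  have [/setDP[cI cM] /setDP[eI eM]] := (cX, eX); have [l1 l2] := andP le_ce.
  rewrite inE; apply/andP; split.
    apply: contra cM => H; move/idealP: idM; apply; first exact: H.
    by rewrite /cell_le /= leqnn.
  by move/idealP: idI; apply; first exact: eI; rewrite /cell_le /= l1 leqnn.
have [l1 l2] := andP le_ce.
have h1 : (c.2 < e.2)%N -> (T c < T (c.1, e.2))%N by move=> h; apply: (tab_row tT).
have h2 : (c.1 < e.1)%N -> (T (c.1, e.2) < T e)%N by move=> h; apply: (tab_col tT).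
case: (ltngtP c.2 e.2) l2 => // h _.
  case: (ltngtP c.1 e.1) l1 => // h' _; first exact: ltn_trans (h1 h) (h2 h').
  have -> : e = (c.1, e.2); last exact: h1.
  by apply/eqP; rewrite cell_eqE /= h' !eqxx.
have E : c = (c.1, e.2) by apply/eqP; rewrite cell_eqE /= h !eqxx.
rewrite {1}E; apply: h2; rewrite ltn_neqAle l1 andbT.
by apply: contra ne_ce => E1; rewrite cell_eqE h eqxx andbT.
Qed.

Lemma first_level_covers T : tableau_spec (I :\: M) T -> covers M (first_level T).
Proof.
move=> tT; apply/coversP; split=> [|c]; first exact: subsetUl.
rewrite !inE => /orP[-> //|/andP[/andP[cM cI] /eqP Tc] _].
have cX : c \in I :\: M by rewrite !inE cM.
apply/addableP; split=> // x le_xc ne_xc; apply/negPn/negP=> xM.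
have xX : x \in I :\: M by rewrite !inE xM; move/idealP: idI; apply; first exact: cI.
have := tableau_mono tT xX cX le_xc ne_xc; have := tab_pos tT xX.
have {}Tc : T c = 1%N :> nat := Tc.
by rewrite Tc; case: (nat_of_ord (T x)).
Qed.

Lemma first_level_sub T : first_level T \subset I.
Proof.
by rewrite subUset sMI; apply/subsetP=> c; rewrite !inE => /andP[/andP[]].
Qed.

Lemma first_level_neq T : M != I -> tableau_spec (I :\: M) T -> first_level T != M.
Proof.
move=> neMI tT; have [c cX] : exists c, c \in I :\: M.
  apply/set0Pn; rewrite setD_eq0; apply: contra neMI => sIM.
  by rewrite eqEsubset sMI.
have [|e eX Te] := tab_all tT (k := 1).
  exact: leq_trans (tab_pos tT cX) (le_max_entry T cX).
have eN : e \in first_level T by apply/setUP; right; rewrite inE eX; apply/eqP.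
by apply/eqP => E; move: eX; rewrite inE -E eN.
Qed.

Lemma lowerK T : tableau_spec (I :\: M) T -> raise (lower T) = T.
Proof.
move=> tT; apply/ffunP=> c; apply/val_inj; rewrite ffunE /=.
case: ifP => cX; last by rewrite /= (tab_out tT) // cX.
by rewrite lowerE prednK ?inordK // (tab_pos tT).
Qed.

Lemma lower_tableau T : tableau_spec (I :\: M) T ->
  tableau_spec (I :\: first_level T) (lower T).
Proof.
move=> tT; have memE c : (c \in I :\: first_level T) = (c \in I :\: M) && (1 < T c)%N.
  rewrite !inE negb_or; case: (boolP (c \in I)) => cI; rewrite ?andbF //= !andbT.
  case: (boolP (c \in M)) => //= cM.
  have := @tab_pos _ _ tT c; rewrite !inE cM cI => /(_ isT).
  by case: (T c) => -[|[|m]].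
split.
- move=> c; rewrite memE lowerE negb_and -leqNgt => /orP[|].
    by move/(tab_out tT)->.
  by case: (nat_of_ord _) => [|[]].
- by move=> c; rewrite memE lowerE => /andP[_]; case: (nat_of_ord _) => [|[]].
- move=> c e; rewrite !memE !lowerE => /andP[cX c1] /andP[eX e1] E lt.
  by have := tab_row tT cX eX E lt; lia.
- move=> c e; rewrite !memE !lowerE => /andP[cX c1] /andP[eX e1] E lt.
  by have := tab_col tT cX eX E lt; lia.
- move=> k /andP[k0 le_k].
  have le_m : (max_entry (I :\: first_level T) (lower T) <= (max_entry (I :\: M) T).-1)%N.
    apply/bigmax_leqP => c; rewrite memE [val _]lowerE => /andP[cX _].
    by have := le_max_entry T cX; lia.
  have le_k1 : (k.+1 <= max_entry (I :\: M) T)%N by lia.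
  have [c cX Tc] := tab_all tT (k := k.+1) le_k1.
  by exists c; rewrite ?memE ?cX ?lowerE Tc.
Qed.

Section Raise.
Variables (N : {set cell}) (T : fill).
Hypotheses (cov : covers M N) (sNI : N \subset I) (neNM : N != M).
Hypothesis tT : tableau_spec (I :\: N) T.

Let sMN : M \subset N := covers_sub cov.

(** All levels are occupied, so there are at most [#|I :\: N|] of them, and [I] has a further cell
    in [N :\: M]. Hence [inord] in [raise] never overflows. *)
Let card_bound : ((max_entry (I :\: N) T).+1 < bound)%N.
Proof.
rewrite ltnS; apply: leq_ltn_trans (max_entry_card tT) _.
apply: leq_trans (max_card (mem I)); apply/proper_card.
have [c cN] : exists c, c \in N :\: M.
  apply/set0Pn; rewrite setD_eq0; apply: contra neNM => s; by rewrite eqEsubset s.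
rewrite properEneq subsetDl andbT; apply/eqP => /setP/(_ c).
by move: cN; rewrite !inE => /andP[_ cN]; rewrite cN (subsetP sNI).
Qed.

Let T_le c : (T c <= max_entry (I :\: N) T)%N.
Proof.
by case: (boolP (c \in I :\: N)) => [|/(tab_out tT)->//]; exact: le_max_entry.
Qed.

Lemma raiseE c : raise T c = (if c \in I :\: M then (T c).+1 else 0)%N :> nat.
Proof.
rewrite ffunE; case: ifP => // _; rewrite inordK //.
by apply: leq_ltn_trans card_bound; rewrite ltnS T_le.
Qed.

Let sX : I :\: N \subset I :\: M. Proof. exact: setDS. Qed.

Lemma raiseK : lower (raise T) = T.
Proof.
apply/ffunP=> c; apply/val_inj; rewrite /= lowerE raiseE.
case: ifP => //= /negbT cX; rewrite (tab_out tT) //.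
by apply: contra cX; apply: (subsetP sX).
Qed.

Lemma first_level_raise : first_level (raise T) = N.
Proof.
apply/setP=> c; rewrite inE [c \in [set _ in _ | _]]inE [val _]raiseE.
case: ifP => /= cX; last first.
  rewrite orbF; apply/idP/idP => [/(subsetP sMN) //|cN].
  by move: cX; rewrite inE (subsetP sNI _ cN) andbT => /negbFE.
have /setDP[cI /negPf->] := cX; rewrite eqSS /=.
apply/eqP/idP => [T0|cN]; last by rewrite (tab_out tT) // inE cN.
by apply/negPn/negP => cN; have := tab_pos tT (c := c); rewrite inE cN cI T0 => /(_ isT).
Qed.

Lemma raise_mono c e : c \in I :\: M -> e \in I :\: M -> cell_le c e -> c != e ->
  ((c \in I :\: N) -> (e \in I :\: N) -> T c < T e)%N -> (raise T c < raise T e)%N.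
Proof.
move=> cX eX le_ce ne_ce H; rewrite !raiseE cX eX ltnS.
have [/setDP[cI cM] /setDP[eI eM]] := (cX, eX); have [_ ad] := coversP _ _ cov.
have [eN|eN] := boolP (e \in N).
  by have /addableP[_ /(_ c le_ce ne_ce)] := ad e eN eM; rewrite (negPf cM).
have eY : e \in I :\: N by rewrite inE eN.
have [cN|cN] := boolP (c \in N).
  by rewrite (tab_out tT) ?(tab_pos tT) // inE cN.
by apply: H => //; rewrite inE cN.
Qed.

Lemma max_entry_raise : max_entry (I :\: M) (raise T) = (max_entry (I :\: N) T).+1.
Proof.
apply/eqP; rewrite eqn_leq; apply/andP; split.
  by apply/bigmax_leqP => c cX; rewrite [val _]raiseE cX ltnS T_le.
have [c0 c0X] : exists c, c \in I :\: M.
  have [c cN] : exists c, c \in N :\: M.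
    apply/set0Pn; rewrite setD_eq0; apply: contra neNM => s; by rewrite eqEsubset s.
  by exists c; move: cN; apply: subsetP; apply: setSD.
case: (posnP (max_entry (I :\: N) T)) => [->|m0].
  by apply: leq_trans (le_max_entry _ c0X); rewrite raiseE c0X.
have [|c cY Tc] := tab_all tT (k := max_entry (I :\: N) T); first by rewrite m0 leqnn.
have cX := subsetP sX _ cY.
by apply: leq_trans (le_max_entry _ cX); rewrite raiseE cX Tc.
Qed.

Lemma raise_tableau : tableau_spec (I :\: M) (raise T).
Proof.
split.
- by move=> c /negPf cX; rewrite raiseE cX.
- by move=> c cX; rewrite raiseE cX.
- move=> c e cX eX E lt; apply: raise_mono => //; last by move=> cY eY; apply: (tab_row tT).
    by rewrite /cell_le E leqnn ltnW.
  by rewrite cell_eqE (ltn_eqF lt) andbF.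
- move=> c e cX eX E lt; apply: raise_mono => //; last by move=> cY eY; apply: (tab_col tT).
    by rewrite /cell_le E leqnn ltnW.
  by rewrite cell_eqE (ltn_eqF lt).
move=> k; rewrite max_entry_raise => /andP[k0 le_k].
have [k1|k1] := leqP k 1.
  have [c cN] : exists c, c \in N :\: M.
    apply/set0Pn; rewrite setD_eq0; apply: contra neNM => s; by rewrite eqEsubset s.
  have cX : c \in I :\: M by move: cN; apply: subsetP; apply: setSD.
  exists c; rewrite // raiseE cX (tab_out tT); first by apply/eqP; rewrite eqn_leq k1 k0.
  by move: cN; rewrite !inE => /andP[_ ->].
have [|c cY Tc] := tab_all tT (k := k.-1); first by case: k k1 le_k {k0} => [|[|k]].
have cX := subsetP sX _ cY.
by exists c; rewrite // raiseE cX Tc prednK.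
Qed.

Lemma sum_entries_raise :
  sum_entries (I :\: M) (raise T) = (#|I :\: M| + sum_entries (I :\: N) T)%N.
Proof.
rewrite /sum_entries (eq_bigr (fun c => 1 + T c)%N); last first.
  by move=> c cX; rewrite [val _]raiseE cX.
rewrite big_split /= sum1_card; congr (_ + _)%N.
rewrite (big_setID (I :\: N)) /= (setIidPr sX) [X in (_ + X)%N]big1 ?addn0 // => c.
by rewrite inE => /andP[/(tab_out tT)].
Qed.

Lemma count_ge_raise1 : count_ge (I :\: M) (raise T) 1 = #|I :\: M|.
Proof.
by apply: eq_card => c; rewrite inE [val _]raiseE; case: (c \in I :\: M).
Qed.

Lemma count_ge_raise k : (0 < k)%N ->
  count_ge (I :\: M) (raise T) k.+1 = count_ge (I :\: N) T k.
Proof.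
move=> k0; apply: eq_card => c; rewrite inE [RHS]inE [val _]raiseE.
case: (boolP (c \in I :\: N)) => [cY|/(tab_out tT) T0]; first by rewrite (subsetP sX).
by case: ifP => // _; rewrite T0 ltnS leqNgt k0.
Qed.

End Raise.

End Peel.

Variables (F : fieldType) (q : F).

Definition tableau_weight X T : F :=
  q ^+ sum_entries X T * \prod_(1 <= k < (max_entry X T).+1) (1 - q ^+ count_ge X T k)^-1.

Definition tableau_series X : F := \sum_(T | is_tableau X T) tableau_weight X T.

(** Raising every cell by one contributes [q ^+ #|I :\: M|]. The new level 1 has all cells at or
    above it, which gives the denominator; the other levels are those of [T], shifted. *)
Lemma tableau_weight_raise I M N T : ideal I -> ideal M -> M \subset I ->
  covers M N -> N \subset I -> N != M -> is_tableau (I :\: N) T ->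
  tableau_weight (I :\: M) (raise I M T) =
  q ^+ #|I :\: M| / (1 - q ^+ #|I :\: M|) * tableau_weight (I :\: N) T.
Proof.
move=> idI idM sMI cov sNI neNM /tableauP tT; rewrite /tableau_weight.
rewrite (sum_entries_raise cov sNI neNM tT) (max_entry_raise cov sNI neNM tT) exprD.
rewrite big_ltn // (count_ge_raise1 cov sNI neNM tT) big_add1 /=.
rewrite (eq_big_nat _ _ (F2 := fun k => (1 - q ^+ count_ge (I :\: N) T k)^-1)); last first.
  by move=> k /andP[k0 _]; rewrite (count_ge_raise cov sNI neNM tT).
by rewrite mulrACA mulrA.
Qed.

Lemma tableau_series_rec I M : ideal I -> ideal M -> M \subset I -> M != I ->
  tableau_series (I :\: M) = q ^+ #|I :\: M| / (1 - q ^+ #|I :\: M|) *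
   \sum_(N | [&& covers M N, N \subset I & N != M]) tableau_series (I :\: N).
Proof.
move=> idI idM sMI neMI; rewrite /tableau_series mulr_sumr.
rewrite (partition_big (first_level I M)
  (fun N => [&& covers M N, N \subset I & N != M])) /=; last first.
  move=> T /tableauP tT; rewrite first_level_covers // first_level_sub //.
  exact: first_level_neq.
apply: eq_bigr => N /and3P[cov sNI neNM]; rewrite mulr_sumr.
rewrite (reindex_onto (raise I M) lower) /=; last first.
  by move=> T /andP[/tableauP tT _]; apply: lowerK.
apply: eq_big => [T|T]; last first.
  move=> /andP[/andP[/tableauP tT /eqP EN] /eqP ET].
  apply: tableau_weight_raise => //; apply/tableauP.
  by rewrite -ET -EN; apply: lower_tableau.
apply/idP/idP => [/andP[/andP[/tableauP tT /eqP EN] /eqP ET]|/tableauP tT].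
  by apply/tableauP; rewrite -ET -EN; apply: lower_tableau.
rewrite (first_level_raise cov sNI neNM tT) (raiseK cov sNI neNM tT) !eqxx !andbT.
by apply/tableauP; exact: (raise_tableau cov sNI neNM tT).
Qed.

Lemma tableau_series0 : tableau_series set0 = 1.
Proof.
rewrite /tableau_series (big_pred1 [ffun=> ord0]) => [|T].
  by rewrite /tableau_weight /sum_entries /max_entry !big_set0 big_geq // mulr1.
apply/tableauP/eqP => [tT|->].
  by apply/ffunP=> c; apply/val_inj; rewrite /= ffunE (tab_out tT) // inE.
split=> [c _|c|c e|c e|k]; rewrite ?inE //; first by rewrite ffunE.
by rewrite /max_entry big_set0 leqn0 => /andP[k0 /eqP E]; rewrite E in k0.
Qed.

End Tableaux.

(** * Comparison of the two recursions *)

Lemma tableau_excited_series (d n : nat) (F : fieldType) (q : F) (I M : {set 'I_d * 'I_n}) :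
  q != 0 -> (forall k, (0 < k)%N -> q ^+ k != 1) ->
  ideal I -> ideal M -> M \subset I ->
  tableau_series q (I :\: M) = excited_series q I M.
Proof.
move=> q0 q1 idI; move: {2}#|_| (leqnn #|I :\: M|) => k.
elim: k M => [|k IH] M le_k idM sMI.
  move: le_k; rewrite leqn0 cards_eq0 setD_eq0 => sIM.
  have -> : M = I by apply/eqP; rewrite eqEsubset sMI.
  by rewrite setDv tableau_series0 excited_series_top.
have [->|neMI] := eqVneq M I; first by rewrite setDv tableau_series0 excited_series_top.
rewrite tableau_series_rec //.
have m0 : (0 < #|I :\: M|)%N.
  by rewrite card_gt0 setD_eq0; apply: contra neMI => s; rewrite eqEsubset sMI.
have nz : 1 - q ^+ #|I :\: M| != 0 by rewrite subr_eq0 eq_sym q1.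
have E := excited_series_rec q0 q1 idI idM sMI.
(* The recursion of the excited series contains the term [N = M]; solving for it produces the
   denominator of the tableau recursion. *)
rewrite (bigD1 M) ?coversxx //= in E.
rewrite (eq_big (fun N => (covers M N && (N \subset I)) && (N != M)) (excited_series q I)).
- apply: (mulfI nz); rewrite mulrA [X in X * _]mulrC divfK // mulrBl mul1r {1}E mulrDr.
  by rewrite addrAC subrr add0r.
- by move=> N; rewrite andbA.
move=> N /and3P[cov sNI neNM]; apply: IH => //; last exact: covers_ideal cov.
rewrite -ltnS; apply: leq_trans le_k; apply/proper_card.
have sMN := covers_sub cov; rewrite properE setDS //=.
apply: contra neNM => /subsetP s; rewrite eqEsubset sMN andbT.
apply/subsetP => x xN; apply/negPn/negP => xM.
by have := s x; rewrite !inE xM xN (subsetP sNI) // => /(_ isT).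
Qed.

(** * From ideals of cells back to partitions *)

Lemma partition_nth (l : seq nat) i j : is_partition l -> (i <= j)%N -> (nth 0 l j <= nth 0 l i)%N.
Proof.
move=> /andP[sl _] le_ij; have [lt_j|] := ltnP j (size l); last by move=> h; rewrite nth_default.
apply: (sorted_leq_nth (leT := geq)) => //.
- by move=> y x z /= h1 h2; apply: leq_trans h1.
- by move=> x /=.
- by rewrite inE; apply: leq_ltn_trans lt_j.
Qed.

Lemma diag_ideal lam mu : is_partition mu -> ideal (diag lam mu).
Proof.
move=> pmu; apply/idealP=> c e; rewrite !inE => h /andP[h1 h2].
by apply: leq_ltn_trans h2 _; apply: leq_trans h _; apply: partition_nth.
Qed.

Lemma diag_sub lam mu : subpartition mu lam -> diag lam mu \subset diag lam lam.
Proof. by move=> s; apply/subsetP=> c; rewrite !inE => h; apply: leq_trans h _. Qed.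

Lemma row_len_diag lam r : is_partition lam -> row_len (diag lam lam) r = nth 0 lam r.
Proof.
move=> pl; rewrite -[RHS](@card_ord_lt (head 0 lam)); last by rewrite -nth0 partition_nth.
by apply: eq_card => j; rewrite !inE.
Qed.

Lemma col_len_diag lam j : col_len (diag lam lam) j = conjpart lam j.
Proof.
rewrite /conjpart -sum1_count (big_nth 0) big_mkord sum1dep_card.
by apply: eq_card => r; rewrite !inE.
Qed.

Lemma hook_diag lam (c : 'I_(size lam) * 'I_(head 0 lam)) : is_partition lam ->
  hook lam (@Defs.row lam c) (@Defs.col lam c) = hook_len (diag lam lam) c.
Proof. by move=> pl; rewrite /hook_len row_len_diag // col_len_diag. Qed.

Lemma qF_neq0 : qF != 0.
Proof. by rewrite /qF tofrac_eq0 polyX_eq0. Qed.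

Lemma qF_aperiodic k : (0 < k)%N -> qF ^+ k != 1.
Proof.
move=> k0; rewrite /qF -tofracXn -tofrac1 tofrac_eq.
apply/eqP => /(congr1 (fun p : {poly rat} => size p)); rewrite size_polyXn size_poly1 => -[E].
by rewrite E in k0.
Qed.

Theorem theorem1p5 (lam mu : seq nat) :
  is_partition lam -> is_partition mu -> subpartition mu lam ->
  SIT_side lam mu = GED_side lam mu.
Proof.
move=> pl pm sub.
transitivity (tableau_series qF (Defs.skew lam mu)).
  by apply: eq_bigl => T; rewrite inE.
rewrite tableau_excited_series ?diag_ideal ?diag_sub ?qF_neq0 //; last exact: qF_aperiodic.
apply: eq_big => [D|D _]; first by rewrite inE.
by apply: eq_bigr => c _; rewrite hook_diag.
Qed.
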